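(* Every nice graph is algebraic $(1,5)$-choosable.
   Context: All graphs are finite and simple, with vertex set $V=\{1,\dots,n\}$; an edge is a $2$-element subset $\{i,j\}$ of $V$. For $i\in V$, $E(i)$ is the set of edges incident to $i$. An edge $\{i,j\}$ is isolated if both $i$ and $j$ have degree $1$; a graph is nice if it has no isolated edges. For a graph $G=(V,E)$ define the polynomial in variables $x_e$ ($e\in E$) $$P_G=\prod_{\{i,j\}\in E,\ i<j}\Big(\sum_{e\in E(i)}x_e-\sum_{e\in E(j)}x_e\Big)$$ (the empty product is $1$). For $K:E\to\mathbb{N}$ write $x^K=\prod_{e\in E}x_e^{K(e)}$, and let $\mathrm{mon}(P)$ be the set of monomials $x^K$ with nonzero coefficient in $P$. For a positive integer $b$, $G$ is algebraic $(1,b)$-choosable if there is $K:E\to\mathbb{N}$ with $\sum_{e\in E}K(e)=|E|$ and $K(e)\le b-1$ for all $e\in E$ such that $x^K\in\mathrm{mon}(P_G)$. (By the Combinatorial Nullstellensatz this implies total weight $(1,b)$-choosability.) *)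

(* Defs.v *)
From mathcomp Require Import all_boot all_order all_algebra.
From mathcomp Require Import mpoly.
Set Implicit Arguments. Unset Strict Implicit. Unset Printing Implicit Defensive.
Import GRing.Theory.
Local Open Scope ring_scope.

(* A finite simple graph on n vertices: vertex set 'I_n (standing for
   {1,...,n}, with the same order), edge set E a set of 2-element subsets. *)
Definition is_graph (n : nat) (E : {set {set 'I_n}}) : Prop :=
  forall e, e \in E -> #|e| = 2%N.

Definition inc_edges n (E : {set {set 'I_n}}) (i : 'I_n) : {set {set 'I_n}} :=
  [set e in E | i \in e].
Definition deg n (E : {set {set 'I_n}}) (i : 'I_n) : nat := #|inc_edges E i|.

Definition nice n (E : {set {set 'I_n}}) : Prop :=
  forall e, e \in E -> ~ (forall i, i \in e -> deg E i = 1%N).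

(* one polynomial variable x_e for every subset e of the vertex set
   (only those with e \in E are used) *)
Definition nvars (n : nat) : nat := #|{set 'I_n}|.
Definition xe n (e : {set 'I_n}) : {mpoly int[nvars n]} := 'X_(enum_rank e).

Definition sum_at n (E : {set {set 'I_n}}) (i : 'I_n) : {mpoly int[nvars n]} :=
  \sum_(e in inc_edges E i) xe e.

Definition PG n (E : {set {set 'I_n}}) : {mpoly int[nvars n]} :=
  \prod_(i : 'I_n) \prod_(j : 'I_n | ((i < j)%N && ([set i; j] \in E)))
     (sum_at E i - sum_at E j).

Definition alg_choosable n (E : {set {set 'I_n}}) (b : nat) : Prop :=
  exists m : 'X_{1..nvars n},
    [/\ m \in msupp (PG E),
        (forall e : {set 'I_n}, e \notin E -> m (enum_rank e) = 0%N),
        (forall e : {set 'I_n}, e \in E -> (m (enum_rank e) <= b.-1)%N)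
      & mdeg m = #|E| ].

(* Main.v *)
Require Import Defs.
From mathcomp Require Import all_boot all_order all_algebra.
From mathcomp Require Import zify ring.
Set Implicit Arguments. Unset Strict Implicit. Unset Printing Implicit Defensive.

(** Let [D(y)] be the product of all [y_i - y_j] over the edges, so that [PG E] is [D]
    at [y_i = sum of the x_e with e containing i]. Up to factorials, a coefficient of
    [PG E] is a mixed derivative of [D] along edge vectors [1_i + 1_j], that is, a
    permanent. By multilinearity it is enough to find as many vectors as there are
    edges, each in the span of a list of edge vectors, such that every edge is listed
    at most 4 times and the mixed derivative along the vectors is nonzero ([cert]).

    Certificates of disjoint graphs can be joined, so let the graph be connected. Take
    a spanning tree in which adjacent vertices are comparable, and build an independent
    set [B] greedily from the bottom, so that each vertex outside [B] has a lower
    neighbour in [B]. For an edge outside [B] with upper end [u] and lower end [c] use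
    the vector [y_u - y_u'], [u'] being the next upper neighbour of [c] outside [B], or
    [y_u -+ y_b] with [b] in [B] if there is none (the exit of [c]). These rows are
    triangular. For the edges at [B] use vectors [+-y_b -+ y_b'], each of them twice
    (except at most one of them), such that each [b] occurs [deg b] times. If [F] is
    the product of such forms, the coefficient of [y^deg] in [F^2] is plus or minus the
    sum of the squares of the coefficients of [F], since [F] is reciprocal up to sign;
    hence it is nonzero. The vectors on [B] are differences of two relays
    [+-y_b + y_w] at a common vertex [w]; that they can be chosen within the loads is
    proved by induction along a spanning tree, with a parity at each vertex. *)

(** * Normal spanning trees *)

(** A form that is used twice costs two loads on every edge listed for its two relays, so the four
    loads of an edge serve two forms. At a vertex outside [B] the relays that arrive are paired; if
    their number is odd, one is sent on to the next vertex up. The link of a vertex [c] that has an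
    exit starts with three loads: two carry a relay upwards, the third lets the exit of [c] leave
    through the upper end of the link when no edge from [c] to [B] has a load to spare. The main
    obstacle is that two relays with the same sign and origin give the zero form. Negative relays,
    which have passed a link, can always be paired with direct ones. Two relays that both come from
    below are kept apart by their origins: either one of them can choose its origin, or both origins
    lie in disjoint branches of the normal tree. Since [B] is built from the bottom, the neighbour
    in [B] guaranteed to each vertex lies below it and is never the upper end of its link, so there
    is always an edge at hand for exits. An odd number at the root is repaired by the one form that
    is used once. Only a component with a single edge has no room for it, and this is where niceness
    enters. *)

Section NormalTree.
Variables (V : finType) (adj : rel V) (r : V).
Hypothesis adj_sym : symmetric adj.
Hypothesis adj_irr : irreflexive adj.
Local Notation C := (connect adj r).

Definition tree_on (p : V -> V) (d : V -> nat) : Prop :=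
  d r = 0 /\ forall x, C x -> x != r -> adj x (p x) /\ d x = (d (p x)).+1.

Definition anc (p : V -> V) (d : V -> nat) (x y : V) :=
  (d x < d y) && (iter (d y - d x) p y == x).

Lemma adj_connect x y : adj x y -> C x = C y.
Proof.
move=> xy; apply/idP/idP => h; apply: connect_trans h _; apply: connect1 => //.
by rewrite adj_sym.
Qed.

Definition reach k x := [exists t : k.-tuple V, path adj r t && (last r t == x)].

Lemma reachS k x : reach k.+1 x -> exists2 y, reach k y & adj y x.
Proof.
case/existsP => t /andP[pt lt]; have := size_tuple t.
case/lastP: (tval t) pt lt => [|s z] //; rewrite rcons_path last_rcons size_rcons.
case/andP=> ps adz /eqP <- [sz]; exists (last r s) => //; apply/existsP.
have sk : size s == k by apply/eqP.
by exists (Tuple sk); rewrite ps eqxx.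
Qed.

Lemma reach_adj k x y : reach k x -> adj x y -> reach k.+1 y.
Proof.
case/existsP => t /andP[pt /eqP lt] xy; apply/existsP.
exists [tuple of rcons t y]; by rewrite rcons_path pt lt xy last_rcons eqxx.
Qed.

Lemma tree_exists : exists p d, tree_on p d.
Proof.
(* Here [distinct_items x] is the distance from [r] to [x]; the parent of [x] is any neighbour at
   distance one less. *)
pose distinct_items x := find (reach^~ x) (iota 0 #|V|).
have reach_has x : C x -> has (reach^~ x) (iota 0 #|V|).
  case/connectP => s ps ->; have [s' ps' us' _] := shortenP ps.
  apply/hasP; exists (size s'); last first.
    by apply/existsP; exists (in_tuple s'); rewrite ps' eqxx.
  by rewrite mem_iota /= add0n; have /card_uniqP := us'; rewrite /= => <-; apply: max_card.
have distR x : C x -> reach (distinct_items x) x.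
  move=> /reach_has hx; have := nth_find 0 hx; rewrite nth_iota //.
  by rewrite -[X in _ < X](size_iota 0) -has_find.
have dist_le k x : k < #|V| -> reach k x -> distinct_items x <= k.
  move=> kV rk; rewrite leqNgt; apply/negP => lt.
  by have := before_find 0 lt; rewrite nth_iota ?add0n // rk.
have dist_lt x : C x -> distinct_items x < #|V|.
  by move=> /reach_has; rewrite has_find size_iota.
pose p x := odflt r [pick y | adj x y && (distinct_items x == (distinct_items y).+1)].
exists p, distinct_items; split.
  apply/eqP; rewrite -leqn0; apply: dist_le; first by apply/card_gt0P; exists r.
  by apply/existsP; exists [tuple]; rewrite /= eqxx.
move=> x Cx xr; rewrite /p; case: pickP => [y /andP[-> /eqP ->] //|none] /=.
have := distR x Cx; have := dist_lt x Cx; case E: (distinct_items x) => [|k] lt rk.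
  case/existsP: rk => t; rewrite (tuple0 t) /= => /eqP rx; by rewrite rx eqxx in xr.
have [y ry yx] := reachS rk.
have := none y; rewrite adj_sym yx E /= eqSS => /negbT; case/negP.
rewrite eqn_leq dist_le ?(ltnW lt) // andbT leqNgt; apply/negP => ky.
have Cy : C y by rewrite (adj_connect yx).
have := reach_adj (distR _ Cy) yx => /dist_le H.
by have := H (leq_ltn_trans ky (ltnW lt)); rewrite E ltnNge ky.
Qed.

Section Facts.
Variables (p : V -> V) (d : V -> nat).
Hypothesis tr : tree_on p d.
Local Notation "x ~< y" := (anc p d x y) (at level 70).

Lemma tree_parent x : C x -> x != r -> C (p x) /\ d x = (d (p x)).+1.
Proof. by move=> Cx xr; have [a ->] := tr.2 x Cx xr; rewrite -(adj_connect a). Qed.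

Lemma tree_d0 x : C x -> d x = 0 -> x = r.
Proof.
move=> Cx d0; apply/eqP; apply/negPn/negP => xr.
by have [_] := tree_parent Cx xr; rewrite d0.
Qed.

Lemma tree_iter k x : C x -> k <= d x -> C (iter k p x) /\ d (iter k p x) = d x - k.
Proof.
move=> Cx; elim: k => [|k IH] kd /=; first by rewrite subn0.
have [Ck dk] := IH (ltnW kd).
have kr : iter k p x != r by apply: contraTneq kd => e; rewrite e tr.1 in dk; lia.
by have [? ?] := tree_parent Ck kr; split=> //; lia.
Qed.

Lemma anc_d x y : x ~< y -> d x < d y. Proof. by case/andP. Qed.

Lemma anc_irr x : (x ~< x) = false. Proof. by rewrite /anc ltnn. Qed.

Lemma anc_asym x y : x ~< y -> y ~< x = false.
Proof. by move=> /anc_d h; apply/negbTE/negP => /anc_d; lia. Qed.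

Lemma anc_conn x y : C y -> x ~< y -> C x /\ y != r.
Proof.
move=> Cy /andP[h /eqP <-]; split; first by have [] := @tree_iter (d y - d x) y Cy (leq_subr _ _).
by apply: contraTneq h => ->; rewrite tr.1.
Qed.

Lemma anc_parent x : C x -> x != r -> p x ~< x.
Proof.
move=> Cx xr; have [_ dx] := tree_parent Cx xr.
by rewrite /anc dx leqnn subSnn /= eqxx.
Qed.

Lemma anc_trans x y z : C z -> x ~< y -> y ~< z -> x ~< z.
Proof.
move=> Cz /andP[xy /eqP e] /andP[yz /eqP e']; rewrite /anc (ltn_trans xy yz) /=.
have -> : d z - d x = (d y - d x) + (d z - d y) by lia.
by rewrite iterD e' e.
Qed.

Lemma anc_step x y : C y -> x ~< y -> x = p y \/ x ~< p y.
Proof.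
move=> Cy xy; have [Cx yr] := anc_conn Cy xy; have [_ dy] := tree_parent Cy yr.
case/andP: xy => h /eqP e.
have [eq|ne] := eqVneq (d x) (d (p y)).
  by left; rewrite -[LHS]e (_ : d y - d x = 1) //; lia.
right; apply/andP; split; first by lia.
by rewrite -iterSr -subSn ?dy in e *; [rewrite e|lia].
Qed.

Lemma anc_total_eq x y z : x ~< z -> y ~< z -> d x = d y -> x = y.
Proof. by move=> /andP[_ /eqP ex] /andP[_ /eqP ey] e; rewrite -ex -ey e. Qed.

Lemma anc_sibling c c' z : C c -> C c' -> C z -> c != r -> c' != r ->
  p c = p c' -> c ~< z -> c' ~< z -> c = c'.
Proof.
move=> Cc Cc' Cz cr cr' e cz cz'.
have [_ dc] := tree_parent Cc cr; have [_ dc'] := tree_parent Cc' cr'.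
by apply: (anc_total_eq cz cz'); rewrite dc dc' e.
Qed.

Lemma tree_bound x : C x -> d x < #|V|.
Proof.
move=> Cx; rewrite -(card_ord (d x).+1).
apply: (@leq_card _ _ (fun i : 'I_(d x).+1 => iter i p x)) => i j e.
apply: val_inj => /=; have := congr1 d e; have li := ltn_ord i; have lj := ltn_ord j.
rewrite (tree_iter Cx _).2 ?(tree_iter Cx _).2; lia.
Qed.
End Facts.

Definition normal_tree p d : Prop :=
  tree_on p d /\ (forall x y, C x -> adj x y -> anc p d x y || anc p d y x).

(** The branch of [u] is hung below [v], which lies outside it. The depth of every vertex in the
    branch grows by [d v + 1 - d u > 0], and no other depth changes. *)
Lemma rehang p d u v : tree_on p d -> C u -> adj u v ->
  ~~ anc p d u v -> ~~ anc p d v u -> u != v -> d u <= d v ->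
  exists p' d', tree_on p' d' /\ \sum_(x | C x) d x < \sum_(x | C x) d' x.
Proof.
move=> tr Cu uv nuv nvu neuv duv.
have Cv : C v by rewrite -(adj_connect uv).
pose below x := (x == u) || anc p d u x.
have ur : u != r.
  apply: contraNneq nuv => e; rewrite e /anc tr.1 subn0.
  have dv : 0 < d v.
    by rewrite lt0n; apply: contraNneq neuv => /(tree_d0 tr Cv) ->; rewrite e.
  rewrite dv /=; apply/eqP; have [Ci di] := tree_iter tr Cv (leqnn (d v)).
  by apply: (tree_d0 tr Ci); rewrite di subnn.
pose p' x := if x == u then v else p x.
pose d' x := if below x then d x - d u + (d v).+1 else d x.
have bv : below v = false by rewrite /below eq_sym (negbTE neuv) (negbTE nuv).
have br : below r = false.
  by rewrite /below eq_sym (negbTE ur) /=; apply/negP => /anc_d; rewrite tr.1.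
have child_budget x : below x -> d u <= d x by case/orP => [/eqP ->|/anc_d/ltnW].
exists p', d'; split; last first.
  rewrite [X in X < _](bigD1 u) //= [X in _ < X](bigD1 u) //= -addSn leq_add //.
    by rewrite /d' /below eqxx /=; lia.
  by apply: leq_sum => x _; rewrite /d'; case: ifP => // /child_budget; lia.
split; first by rewrite /d' br tr.1.
move=> x Cx xr; rewrite /p'; have [->|xu] := eqVneq x u.
  by rewrite uv /d' bv /below eqxx /= subnn.
have [ax dx] := tr.2 x Cx xr; split=> //.
have -> : d' (p x) = if below x then d (p x) - d u + (d v).+1 else d (p x).
  rewrite /d'; congr (if _ then _ else _); rewrite /below (negbTE xu) /=.
  apply/idP/idP => [/orP[/eqP <-|h]|/(anc_step tr Cx)[->|->]]; rewrite ?eqxx ?orbT //.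
    exact: anc_parent.
  by apply: anc_trans h _ => //; apply: anc_parent.
rewrite /d'; case: ifP => // bx.
have : d u < d x by case/orP: bx => [/eqP e|/anc_d //]; rewrite e eqxx in xu.
by rewrite dx ltnS => le; rewrite subSn // addSn.
Qed.

(** A spanning tree of maximal total depth is normal, because an edge between incomparable vertices
    would allow a rehanging. The total depth is bounded by the square of the number of vertices. *)
Lemma normal_tree_exists : exists p d, normal_tree p d.
Proof.
have [p [d tr]] := tree_exists.
have [k] := ubnP (#|V| * #|V| - \sum_(x | C x) d x); elim: k p d tr => // k IH p d tr lek.
case: (boolP [forall x, forall y, C x ==> adj x y ==> (anc p d x y || anc p d y x)]).
  move=> H; exists p, d; split=> // x y Cx xy.
  by move/forallP/(_ x)/forallP/(_ y): H; rewrite Cx xy.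
case/forallPn => x /forallPn[y]; rewrite !negb_imply negb_or => /and4P[Cx xy nxy nyx].
have ne : x != y by apply: contraTneq xy => ->; rewrite adj_irr.
have [p' [d' [tr' lt]]] : exists p' d', tree_on p' d' /\
    \sum_(z | C z) d z < \sum_(z | C z) d' z.
  have [le|lt] := leqP (d x) (d y); first exact: (@rehang p d x y).
  apply: (@rehang p d y x) => //; rewrite ?(ltnW lt) 1?eq_sym -?(adj_connect xy) //.
  by rewrite adj_sym.
apply: (IH p' d' tr'); suff : \sum_(z | C z) d' z <= #|V| * #|V| by lia.
apply: (@leq_trans (\sum_(z | C z) #|V|)).
  by apply: leq_sum => z Cz; apply: ltnW; exact: (tree_bound tr' Cz).
by rewrite sum_nat_const leq_mul2r max_card orbT.
Qed.
End NormalTree.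

(** * A bottom-up independent set and the link tree *)

(** The recursion goes to vertices of larger [d]. It is run with fuel, and its value at [v] is final
    as soon as the fuel exceeds [M - d v]. *)
Lemma greedy_kernel (V : finType) (below : rel V) (d : V -> nat) :
  (forall x y, below x y -> d x < d y) ->
  exists B : pred V, forall v, B v = ~~ [exists u, below v u && B u].
Proof.
move=> child_budget; pose M := \max_x d x.
have dM x : d x <= M by apply: leq_bigmax.
pose f := fix f k v := if k is k'.+1 then ~~ [exists u, below v u && f k' u] else true.
have fS k v : M - d v < k -> f k v = f k.+1 v.
  elim: k v => // k IH v lt; congr (~~ _); apply: eq_existsb => u.
  case vu: (below v u) => //; apply: IH.
  by have := child_budget _ _ vu; have := dM u; lia.
exists (f M.+1) => v; congr (~~ _); apply: eq_existsb => u.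
case vu: (below v u) => //; apply: fS.
by have := child_budget _ _ vu; have := dM u; lia.
Qed.

Section Structure.
Variables (V : finType) (adj : rel V) (r : V) (p : V -> V) (d : V -> nat) (B : pred V).
Hypotheses (adj_sym : symmetric adj) (adj_irr : irreflexive adj).
Hypothesis nt : normal_tree adj r p d.
Local Notation C := (connect adj r).
Local Notation "x ~< y" := (anc p d x y) (at level 70).
Hypothesis adjC : forall x y, adj x y -> C x.
Hypothesis Bspec : forall v, B v = ~~ [exists u, (adj v u && (v ~< u)) && B u].

Let tr := nt.1.

Lemma B_indep x y : adj x y -> B x -> B y -> False.
Proof.
move=> xy; have yx : adj y x by rewrite adj_sym.
case/orP: (nt.2 x y (adjC xy) xy) => a; rewrite ![B _]Bspec => /existsPn Hx /existsPn Hy.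
  have := Hx y; rewrite xy a /= => /negP; apply; rewrite Bspec; exact/existsPn.
have := Hy x; rewrite yx a /= => /negP; apply; rewrite Bspec; exact/existsPn.
Qed.

Lemma B_low w : ~~ B w -> exists b, [/\ adj w b, w ~< b & B b].
Proof. by rewrite Bspec negbK => /existsP[b /andP[/andP[? ?] ?]]; exists b. Qed.

Definition upA c := [set u | [&& adj c u, ~~ B u & u ~< c]].
Definition needy c := ~~ B c && (upA c != set0).

(* The lowest upper neighbour of [c] outside [B] if there is one, else the tree parent. *)
Definition link c := if c == r then r else if B c then p c else
  odflt (p c) [pick u in upA c | [forall v in upA c, d v <= d u]].

Lemma upA_C c u : u \in upA c -> C c.
Proof. by rewrite inE => /and3P[/adjC]. Qed.

Lemma upA_r c u : u \in upA c -> c != r.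
Proof. by move=> uc; have Cc := upA_C uc; move: uc; rewrite inE => /and3P[_ _ /(anc_conn adj_sym tr Cc)[]]. Qed.

Lemma needyC c : needy c -> C c.
Proof. by case/andP=> _ /set0Pn[u /upA_C]. Qed.

Lemma needy_r c : needy c -> c != r.
Proof. by case/andP=> _ /set0Pn[u /upA_r]. Qed.

Lemma needyP c : needy c -> [/\ ~~ B c, link c \in upA c & forall u, u \in upA c -> d u <= d (link c)].
Proof.
move=> nc; have cr := needy_r nc; case/andP: nc => Bc /set0Pn[u uc].
rewrite /link (negbTE cr) (negbTE Bc); case: pickP => [v /andP[vc /forall_inP vm] //|none].
case: (@arg_maxnP _ u (mem (upA c)) d uc) => v vc vm.
by have := none v; rewrite /= [v \in _]vc /=; case/negP; apply/forall_inP => w /vm.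
Qed.

Lemma nonneedy_q c : C c -> c != r -> ~~ needy c -> link c = p c.
Proof.
move=> Cc cr; rewrite /needy negb_and negbK negbK /link (negbTE cr).
case: (B c) => //= /eqP ->; case: pickP => // v; by rewrite inE.
Qed.

(** Upper neighbours are ancestors, and the parent is the deepest ancestor; if it is outside [B] it
    must be the link. *)
Lemma parent_upA c : C c -> c != r -> ~~ B c -> ~~ B (p c) -> needy c /\ link c = p c.
Proof.
move=> Cc cr Bc Bp; have [ap dp] := tr.2 c Cc cr.
have pu : p c \in upA c by rewrite inE ap Bp /=; apply: (anc_parent adj_sym tr).
have nc : needy c by rewrite /needy Bc; apply/set0Pn; exists (p c).
split=> //; have [_ qu qm] := needyP nc; have := qm _ pu => le.
have qa : link c ~< c by move: qu; rewrite inE => /and3P[].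
have [//|qp] := anc_step adj_sym tr Cc qa.
by have := anc_d qp; rewrite ltnNge le.
Qed.

Lemma link_root : link r = r. Proof. by rewrite /link eqxx. Qed.

Lemma link_props c : C c -> c != r -> [/\ adj c (link c), link c ~< c & C (link c)].
Proof.
move=> Cc cr; have [nc|nnc] := boolP (needy c).
  have [_ qu _] := needyP nc; move: qu; rewrite inE => /and3P[a _ b]; split=> //.
  by have [] := anc_conn adj_sym tr Cc b.
rewrite nonneedy_q //; have [a _] := tr.2 c Cc cr; split=> //.
  exact: (anc_parent adj_sym tr).
by rewrite -(adj_connect r adj_sym a).
Qed.

Lemma link_d c : C c -> c != r -> d (link c) < d c.
Proof. by move=> Cc cr; have [_ /anc_d] := link_props Cc cr. Qed.

Lemma link_needy c : needy c -> ~~ B (link c).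
Proof. by case/needyP => _; rewrite inE => /and3P[]. Qed.

Lemma link_B c : C c -> c != r -> B c -> link c = p c /\ ~~ B (link c).
Proof.
move=> Cc cr Bc; have nn : ~~ needy c by rewrite /needy Bc.
split; first exact: nonneedy_q.
by apply/negP => /(B_indep _ Bc); apply; have [] := link_props Cc cr.
Qed.

Lemma link_piece c : C c -> c != r -> ~~ B c -> ~~ needy c -> B (link c).
Proof.
move=> Cc cr Bc nn; rewrite nonneedy_q //; apply/negPn/negP => Bp.
by have [] := parent_upA Cc cr Bc Bp; rewrite (negbTE nn).
Qed.

(** * Neighbours in the independent set and children in the link tree *)

Definition B_nbrs w := [set b | adj w b && B b].
Definition free_nbrs w := [set b in B_nbrs w | (link b != w) && (link w != b)].
Definition children v := [set c | [&& C c, c != r & link c == v]].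

Lemma chP v c : reflect [/\ C c, c != r & link c = v] (c \in children v).
Proof. by rewrite inE; apply: (iffP and3P) => -[? ? /eqP ?]. Qed.

Lemma children_d v c : c \in children v -> d v < d c.
Proof. by case/chP => Cc cr <-; apply: link_d. Qed.

Lemma children_adj v c : c \in children v -> adj v c.
Proof. by case/chP => Cc cr <-; rewrite adj_sym; have [] := link_props Cc cr. Qed.

Lemma children_anc v c : c \in children v -> v ~< c.
Proof. by case/chP => Cc cr <-; have [] := link_props Cc cr. Qed.

(** An edge from [w] to [b] in [B] is no link at all, or the link of [b], or the link of [w]; the
    three cases exclude each other by depth. *)
Lemma B_nbrs_split w : ~~ B w ->
  B_nbrs w = (free_nbrs w :|: [set b in children w | B b]) :|: [set b | [&& b == link w, B b & w != r]] :> {set V}.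
Proof.
move=> Bw; apply/setP => b; rewrite !inE.
apply/andP/idP => [[wb Bb]|].
  rewrite wb Bb /=; have Cb : C b by apply: (@adjC b w); rewrite adj_sym.
  have [qb|nqb] := eqVneq (link b) w.
    suff br : b != r by rewrite Cb br /= ?orbT.
    by apply: contraNneq Bw => br; rewrite -qb br link_root -br.
  have [qw|nqw] := eqVneq (link w) b; rewrite ?andbF ?orbT //=.
  by apply: contraNneq Bw => wr; rewrite wr link_root in qw; rewrite wr qw.
case/orP => [/orP[/andP[/andP[-> ->]] //|/andP[/and3P[Cb br /eqP qb] Bb]]|/and3P[/eqP -> Bb wr]].
  by split=> //; rewrite adj_sym -qb; have [] := link_props Cb br.
split=> //; suff Cw : C w by have [] := link_props Cw wr.
have [b0 [wb0 _ _]] := B_low Bw; exact: adjC wb0.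
Qed.

Lemma B_nbrs_low w : ~~ B w -> exists2 b, b \in B_nbrs w & w ~< b.
Proof. by case/B_low => b [? ? ?]; exists b => //; rewrite inE; apply/andP. Qed.

(* The single neighbour of [c] in [B] lies below [c], so it is not the parent. *)
Lemma B_nbrs1_parent c : C c -> c != r -> ~~ B c -> #|B_nbrs c| <= 1 -> needy c /\ link c = p c.
Proof.
move=> Cc cr Bc c1; apply: parent_upA => //; apply/negP => Bp.
have [b bN chip] := B_nbrs_low Bc; have [ap _] := tr.2 c Cc cr.
have pN : p c \in B_nbrs c by rewrite inE ap Bp.
have pc := anc_parent adj_sym tr Cc cr.
have e : b = p c by move/card_le1P: c1 => /(_ _ bN)/(_ (p c)); rewrite pN => /esym/eqP.
by have := anc_d chip; have := anc_d pc; rewrite e; lia.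
Qed.

(** * Subtrees of the link tree and sums over them *)

Definition in_subtree v x := C x && fconnect link x v.

Lemma fconnect_step x v : fconnect link x v = (x == v) || fconnect link (link x) v.
Proof.
apply/idP/orP => [/connectP[[|y s] /= ps ->]|[/eqP ->|h]].
- by left.
- by case/andP: ps => /eqP -> ps; right; apply/connectP; exists s.
- exact: connect0.
by apply: connect_trans h; apply: connect1 => /=.
Qed.

Lemma sub_step x v : C x -> x != r -> in_subtree v x = (x == v) || in_subtree v (link x).
Proof.
move=> Cx xr; rewrite /in_subtree Cx fconnect_step.
by have [_ _ ->] := link_props Cx xr.
Qed.

Lemma sub_r v : in_subtree v r = (v == r).
Proof.
rewrite /in_subtree connect0 /=; apply/idP/eqP => [|->]; last exact: connect0.
case/connectP => s; elim: s => [_ ->|y s IH] //=.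
by rewrite link_root => /andP[/eqP <-].
Qed.

Lemma sub_d v x : in_subtree v x -> d v <= d x.
Proof.
have [k] := ubnP (d x); elim: k x => // k IH x lt /[dup] sv /andP[Cx _].
have [xr|xr] := eqVneq x r; first by move: sv; rewrite xr sub_r => /eqP ->.
have lq := link_d Cx xr; move: sv; rewrite sub_step // => /orP[/eqP -> //|/IH H].
by have := H; lia.
Qed.

(** The subtrees of the children partition the subtree of [v] without [v]; this is stated as a count
    so that sums can be exchanged. In the induction, [x] and [link x] lie below the same children of
    [v], except when [x] is itself a child. *)
Lemma sum_ch_sub v x : C v -> \sum_(c in children v) (in_subtree c x : nat) = in_subtree v x && (x != v).
Proof.
move=> Cv; have [k] := ubnP (d x); elim: k x => // k IH x lt.
have [Cx|nCx] := boolP (C x); last first.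
  by rewrite /in_subtree (negbTE nCx) big1.
have [->|xv] := eqVneq x v.
  rewrite andbF big1 // => c cv; apply/eqP; rewrite eqb0; apply/negP => /sub_d.
  by have := children_d cv; lia.
rewrite andbT; have [xr|xr] := eqVneq x r.
  rewrite xr sub_r eq_sym -xr (negbTE xv) big1 // => c /chP[_ cr _].
  by rewrite xr sub_r (negbTE cr).
have lq := link_d Cx xr; rewrite sub_step // (negbTE xv) /=.
rewrite (eq_bigr (fun c => (x == c : nat) + (in_subtree c (link x) : nat))); last first.
  move=> c cv; rewrite sub_step //; have [e|//] := eqVneq x c => /=.
  by case E: (in_subtree c (link x)) => //; have := sub_d E; rewrite -e; lia.
rewrite big_split /= IH; last by lia.
have -> : \sum_(c in children v) (x == c : nat) = (link x == v).
  rewrite -big_mkcondr /= sum1_card; have [qv|qv] := eqVneq (link x) v.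
    rewrite (eq_card (B := pred1 x)) ?card1 // => c; rewrite unfold_in /= [RHS]inE eq_sym.
    by have [->|] := eqVneq c x; rewrite ?andbF // andbT; apply/chP.
  apply: eq_card0 => c; rewrite unfold_in /=; apply/negP => /andP[/chP[_ _ qc] /eqP xc].
  by rewrite xc qc eqxx in qv.
have [->|_] := eqVneq (link x) v; last by rewrite andbT.
by rewrite andbF /= addn0 /in_subtree Cv connect0.
Qed.

Section Weights.
Variables (M : zmodType) (f g : V -> M).
Local Open Scope ring_scope.
Import GRing.Theory.

(** [f] is a weight on vertices and [g] a weight on links, attached to their lower ends; the link
    that leaves the subtree at [v] is not counted. *)
Definition subtree_sum v : M := \sum_(x | in_subtree v x) f x + \sum_(x | in_subtree v x && (x != v)) g x.

Lemma sum_sub_ch (h : V -> M) v : C v ->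
  \sum_(x | in_subtree v x && (x != v)) h x = \sum_(c in children v) \sum_(x | in_subtree c x) h x.
Proof.
move=> Cv; rewrite [RHS](eq_bigr (fun c => \sum_x h x *+ in_subtree c x)); last first.
  by move=> c _; rewrite big_mkcond; apply: eq_bigr => x _; case: (in_subtree c x).
rewrite exchange_big /= big_mkcond; apply: eq_bigr => x _.
by rewrite sumrMnr sum_ch_sub //; case: (_ && _).
Qed.

Lemma sum_sub (h : V -> M) v : C v ->
  \sum_(x | in_subtree v x) h x = h v + \sum_(x | in_subtree v x && (x != v)) h x.
Proof. by move=> Cv; rewrite (bigD1 v) //= /in_subtree Cv connect0. Qed.

Lemma subtree_sum_rec v : C v -> subtree_sum v = f v + \sum_(c in children v) (g c + subtree_sum c).
Proof.
move=> Cv; rewrite {1}/subtree_sum sum_sub // !sum_sub_ch // -addrA -big_split /=.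
congr (_ + _); apply: eq_bigr => c /chP[Cc _ _].
by rewrite (sum_sub g) // /subtree_sum addrCA.
Qed.

Lemma sub_root x : in_subtree r x = C x.
Proof.
apply/idP/idP => [/andP[] //|Cx]; have [k] := ubnP (d x); elim: k x Cx => // k IH x Cx lt.
have [->|xr] := eqVneq x r; first by rewrite sub_r.
have lq := link_d Cx xr; have [_ _ Cq] := link_props Cx xr.
by rewrite sub_step // IH ?orbT //; lia.
Qed.

Lemma subtree_sum_root : subtree_sum r = \sum_(x | C x) f x + \sum_(x | C x && (x != r)) g x.
Proof. by rewrite /subtree_sum; congr (_ + _); apply: eq_bigl => x; rewrite sub_root. Qed.
End Weights.

End Structure.

Import Order.TTheory GRing.Theory Num.Theory.
Local Open Scope ring_scope.

(** * Budgets *)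

Notation budget V := {ffun (V + V + {set V})%type -> int}.

Ltac blia := rewrite /=; repeat match goal with
  | |- context [Posz (nat_of_bool ?b)] => generalize (nat_of_bool b)
  | |- context [fun_of_fin ?a ?i] => generalize (fun_of_fin a i)
  end; clear; intros; lia.

Section Budgets.
Variables (V : finType) (adj : rel V) (B : pred V).
Local Notation bud := (budget V).

(* Coordinates: chips of a vertex of [B], exits of a vertex, load of an edge. *)
Definition bone (i : V + V + {set V}) : bud := [ffun j => Posz (i == j)].
Definition chip v := bone (inl (inl v)).
Definition exit_of v := bone (inl (inr v)).
Definition load e := bone (inr e).

(** Chips and exits have to be met exactly, since they fix the monomial and the rows; loads are only
    upper bounds. *)
Definition ble (a b : bud) : Prop :=
  forall i, if i is inr _ then a i <= b i else a i = b i.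

(* A relay [(s, b, S)] at [w] stands for [(-1)^s y_b + y_w], which lies in the
   span of the edge vectors of [S]. *)
Definition relay := ((bool * V) * seq {set V})%type.

Inductive relay_at : V -> relay -> Prop :=
| relay_direct w b : adj w b -> B b -> relay_at w (false, b, [:: [set w; b]])
| relay_pass c w s b S : relay_at c (s, b, S) -> adj c w -> relay_at w (~~ s, b, [set c; w] :: S).

Definition edges_load (S : seq {set V}) : bud := \sum_(e <- S) load e.
Definition relay_load (u : relay) : bud := chip u.1.2 + edges_load u.2 *+ 2.

(* [feasible k a]: the budget [a] pays for some exits and for some forms, a form
   being the difference of two relays at the same vertex, where [k] forms are used
   once and all others twice. Each form gives one chip to both of its origins, but
   a form that is used once gives one to its first origin only. *)
Inductive feasible : nat -> bud -> Prop :=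
| feasible_nil : feasible 0 0
| feasible_pair k a w u1 u2 : relay_at w u1 -> relay_at w u2 -> u1.1 != u2.1 -> feasible k a ->
    feasible k (a + relay_load u1 + relay_load u2)
| feasible_exit k a y u : relay_at y u -> feasible k a -> feasible k (a + exit_of y + edges_load u.2)
| feasible_lin k a w u1 u2 : relay_at w u1 -> relay_at w u2 -> u1.1 != u2.1 -> feasible k a ->
    feasible k.+1 (a + chip u1.1.2 + edges_load u1.2 + edges_load u2.2)
| feasible_mono k a b : feasible k a -> ble a b -> feasible k b.

Lemma budD (a b : bud) i : (a + b) i = a i + b i. Proof. by rewrite ffunE. Qed.
Lemma budN (a : bud) i : (- a) i = - a i. Proof. by rewrite ffunE. Qed.
Lemma budMn (a : bud) n i : (a *+ n) i = a i *+ n. Proof. by rewrite ffunMnE. Qed.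
Lemma bud0 i : (0 : bud) i = 0. Proof. by rewrite ffunE. Qed.
Lemma cbE v i : chip v i = if i is inl (inl x) then Posz (v == x) else 0.
Proof. by rewrite ffunE; case: i => [[x|x]|x]. Qed.
Lemma owE v i : exit_of v i = if i is inl (inr x) then Posz (v == x) else 0.
Proof. by rewrite ffunE; case: i => [[x|x]|x]. Qed.
Lemma deE e i : load e i = if i is inr x then Posz (e == x) else 0.
Proof. by rewrite ffunE; case: i => [[x|x]|x]. Qed.
Definition budE := (budD, budN, budMn, bud0, cbE, owE, deE).
Hint Rewrite budD budN budMn bud0 cbE owE deE : bud.

Ltac bl := move=> [[?|?]|?]; rewrite ?/edges_load ?big_cons ?big_nil; autorewrite with bud; blia.

Lemma feasible_join k k' a b : feasible k a -> feasible k' b -> feasible (k + k')%N (a + b).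
Proof.
move=> g g'; elim: g => {k a} [|k a w u1 u2 h1 h2 ne _ IH|k a y u h _ IH|k a w u1 u2 h1 h2 ne _ IH|k a c _ IH le].
- by rewrite add0r.
- by apply: feasible_mono (feasible_pair h1 h2 ne IH) _; bl.
- by apply: feasible_mono (feasible_exit h IH) _; bl.
- by apply: feasible_mono (feasible_lin h1 h2 ne IH) _; bl.
- by apply: feasible_mono IH _; move=> i; have := le i; case: i => [?|?]; rewrite !budE /=; lia.
Qed.

Lemma feasible_sum0 (T : eqType) (s : seq T) (f : T -> bud) :
  (forall x, x \in s -> feasible 0 (f x)) -> feasible 0 (\sum_(x <- s) f x).
Proof.
elim: s => [|x s IH] H; first by rewrite big_nil; apply: feasible_nil.
rewrite big_cons -[0%N]/(0 + 0)%N; apply: feasible_join; first by apply: H; rewrite mem_head.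
by apply: IH => y ys; apply: H; rewrite in_cons ys orbT.
Qed.

(** * Pairing the relays at a vertex outside the independent set *)

Section Node.
Variables (w : V) (child_budget : V -> bud) (loc : V -> V -> bool).

Definition edge_load b := load [set w; b].
Definition direct b : relay := (false, b, [:: [set w; b]]).

Lemma relay_load_dir b : relay_load (direct b) = chip b + edge_load b *+ 2.
Proof. by rewrite /relay_load /edges_load big_seq1. Qed.

Lemma edges_load_dir b : edges_load (direct b).2 = edge_load b.
Proof. by rewrite /edges_load big_seq1. Qed.

(* The four kinds of items below [w]. A single item puts one chip of [b] on the
   edge [{w, b}] and leaves a load of 2 on it unused; a double item puts 0 or 2
   chips there. An odd item delivers one relay to [w]: either one with a prescribed
   origin region [loc k], or a negative one at the price of a load on an edge
   [{w, x}], through which an exit is redirected. An even item delivers none. *)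
Definition single_item b := [/\ adj w b, B b & feasible 0 (child_budget b - chip b - edge_load b *+ 4)].
Definition double_item b := [/\ adj w b, B b, feasible 0 (child_budget b - edge_load b *+ 4)
  & feasible 0 (child_budget b - chip b *+ 2 - edge_load b *+ 4)].
Definition odd_item_spec k :=
  (exists u, [/\ relay_at w u, loc k u.1.2 & feasible 0 (child_budget k - relay_load u)]) /\
  (forall x, adj w x -> B x -> exists u, [/\ relay_at w u, u.1.1 & feasible 0 (child_budget k + edge_load x - relay_load u)]).
Definition even_item_spec c := feasible 0 (child_budget c) /\ (exists u, [/\ relay_at w u, u.1.1 &
  forall x, adj w x -> B x -> feasible 0 (child_budget c + edge_load x - edges_load u.2)]).
(** What is needed to pair two odd items: equal relays would give the zero form. *)
Definition distinct_items k k' := exists u u',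
  [/\ relay_at w u, relay_at w u', u.1 != u'.1, feasible 0 (child_budget k - relay_load u) & feasible 0 (child_budget k' - relay_load u')].

(** The lists hold the single ([D]), double ([O]), odd ([K]) and even ([E]) items. The number of
    relays to be paired has the parity of [size D + size K]. *)
Definition node (D O K E : seq V) :=
  [/\ uniq (D ++ O), {in D, forall b, single_item b} & {in O, forall b, double_item b}] /\
  [/\ uniq K, {in K, forall k, odd_item_spec k}, {in K &, forall k k', k != k' -> distinct_items k k'}
    & {in E, forall c, even_item_spec c}].

Definition budget_sum (s : seq V) : bud := \sum_(b <- s) child_budget b.
Definition items_total (D O K E : seq V) : bud :=
  budget_sum D + budget_sum O + budget_sum K + budget_sum E.
(** Of the four loads on the edge to a single or double item, the basic pairing spends at most two;
    this is the rest that is guaranteed. *)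
Definition slack (s : seq V) : bud := \sum_(b <- s) edge_load b *+ 2.

Ltac atoms := rewrite /edge_load /=; repeat match goal with
  | |- context [items_total ?D ?O ?K ?E] => move: (items_total D O K E) => ?
  | |- context [slack ?s] => move: (slack s) => ?
  | |- context [child_budget ?x] => move: (child_budget x) => ?
  | |- context [relay_load ?u] => move: (relay_load u) => ?
  | |- context [edges_load ?u] => move: (edges_load u) => ?
  | |- context [budget_sum ?s] => move: (budget_sum s) => ?
  end.

Lemma feasible_slack k (a : bud) s : feasible k (a - slack s) -> feasible k a.
Proof.
elim: s => [|b s IH]; rewrite /slack ?big_nil ?subr0 // big_cons => g.
by apply: IH; apply: feasible_mono g _; rewrite -/(slack s); atoms; bl.
Qed.

Lemma feasible_slack_in k (a : bud) s b : b \in s -> feasible k (a - slack s) -> feasible k (a - edge_load b *+ 2).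
Proof.
move=> bs g; apply: (@feasible_slack _ _ (rem b s)); apply: feasible_mono g _.
suff -> : slack s = edge_load b *+ 2 + slack (rem b s) by atoms; bl.
by rewrite /slack (perm_big _ (perm_to_rem bs)) big_cons.
Qed.

Lemma pairD D : uniq D -> {in D, forall b, single_item b} -> ~~ odd (size D) ->
  feasible 0 (budget_sum D - slack D).
Proof.
have [m] := ubnP (size D); elim: m D => // m IH [|d1 [|d2 D]] //= lt.
  by move=> _ _ _; rewrite /budget_sum /slack !big_nil subr0; apply: feasible_nil.
rewrite inE negb_or negbK -andbA => /and4P[n1 _ n2 u] H ev.
have [a1 b1 g1] : single_item d1 by apply: H; rewrite !inE eqxx.
have [a2 b2 g2] : single_item d2 by apply: H; rewrite !inE eqxx orbT.
have g : feasible 0 (budget_sum D - slack D).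
  by apply: (IH D _ u _ ev); [exact: ltnW | move=> b bD; apply: H; rewrite !inE bD !orbT].
have ne : (direct d1).1 != (direct d2).1 by rewrite xpair_eqE.
have := feasible_pair (relay_direct a1 b1) (relay_direct a2 b2) ne (feasible_join (feasible_join g1 g2) g).
rewrite -!/(direct _) !relay_load_dir => h; apply: feasible_mono h _.
rewrite /budget_sum /slack !big_cons -/(slack D) -/(budget_sum D); atoms; bl.
Qed.

Lemma pairK K : uniq K -> {in K &, forall k k', k != k' -> distinct_items k k'} -> ~~ odd (size K) ->
  feasible 0 (budget_sum K).
Proof.
have [m] := ubnP (size K); elim: m K => // m IH [|d1 [|d2 D]] //= lt.
  by move=> _ _ _; rewrite /budget_sum !big_nil; apply: feasible_nil.
rewrite inE negb_or negbK -andbA => /and4P[n1 _ n2 u] H ev.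
have [|||u1 [u2 [i1 i2 ne g1 g2]]] := H d1 d2; rewrite ?inE ?eqxx ?orbT //.
have g : feasible 0 (budget_sum D).
  by apply: (IH D _ u _ ev); [exact: ltnW | move=> b b' bD bD'; apply: H; rewrite !inE ?bD ?bD' !orbT].
apply: feasible_mono (feasible_pair i1 i2 ne (feasible_join (feasible_join g1 g2) g)) _.
by rewrite /budget_sum !big_cons -/(budget_sum D); atoms; bl.
Qed.

Lemma node_base D O K E : node D O K E -> ~~ odd (size D) -> ~~ odd (size K) ->
  feasible 0 (items_total D O K E - slack (D ++ O)).
Proof.
move=> [[uDO HD HO] [uK HK Hd HE]] eD eK.
have uD : uniq D by move: uDO; rewrite cat_uniq => /and3P[].
have gO : feasible 0 (budget_sum O - slack O).
  rewrite /budget_sum /slack -sumrB; apply: feasible_sum0 => b /HO[_ _ g _].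
  by apply: feasible_mono g _; atoms; bl.
have gE : feasible 0 (budget_sum E) by apply: feasible_sum0 => c /HE[].
apply: feasible_mono (feasible_join (feasible_join (pairD uD HD eD) gO) (feasible_join (pairK uK Hd eK) gE)) _.
have -> : slack (D ++ O) = slack D + slack O by rewrite /slack big_cat.
by rewrite /items_total; atoms; bl.
Qed.

Lemma node_consD d D O K E : node (d :: D) O K E -> single_item d /\ node D O K E.
Proof.
move=> [[/= /andP[_ u] HD HO] H]; split; first by apply: HD; rewrite mem_head.
by split=> //; split=> // b bD; apply: HD; rewrite inE bD orbT.
Qed.

Lemma node_consO b D O K E : node D (b :: O) K E ->
  [/\ double_item b, node D O K E & b \notin D ++ O].
Proof.
move=> [[u HD HO] H]; have p : perm_eq (D ++ b :: O) (b :: (D ++ O)).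
  by rewrite -cat_rcons -cats1 -catA -cat_cons perm_catC /= perm_cons perm_catC.
move: u; rewrite (perm_uniq p) /= => /andP[bn u]; split=> //.
  by apply: HO; rewrite mem_head.
by split=> //; split=> // x xO; apply: HO; rewrite inE xO orbT.
Qed.

Lemma node_consK k D O K E : node D O (k :: K) E -> odd_item_spec k /\ node D O K E.
Proof.
move=> [H [/= /andP[_ u] HK Hd HE]]; split; first by apply: HK; rewrite mem_head.
split=> //; split=> // [x xK|x y xK yK]; first by apply: HK; rewrite inE xK orbT.
by apply: Hd; rewrite inE ?xK ?yK orbT.
Qed.

Lemma node_perm D D' O O' K E : perm_eq D D' -> perm_eq O O' ->
  node D O K E -> node D' O' K E /\ items_total D O K E = items_total D' O' K E.
Proof.
move=> pD pO [[u HD HO] H]; split.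
  split=> //; split; first by rewrite -(perm_uniq (perm_cat pD pO)).
    by move=> b; rewrite -(perm_mem pD); apply: HD.
  by move=> b; rewrite -(perm_mem pO); apply: HO.
by rewrite /items_total /budget_sum (perm_big _ pD) (perm_big _ pO).
Qed.

Lemma T_D d D O K E : items_total (d :: D) O K E = child_budget d + items_total D O K E.
Proof. by rewrite /items_total /budget_sum big_cons -!addrA. Qed.

Lemma T_O d D O K E : items_total D (d :: O) K E = child_budget d + items_total D O K E.
Proof. by rewrite /items_total /budget_sum big_cons addrCA -!addrA. Qed.

Lemma T_K d D O K E : items_total D O (d :: K) E = child_budget d + items_total D O K E.
Proof. by rewrite /items_total /budget_sum big_cons addrCA -!addrA. Qed.

Lemma slack_cons b s : slack (b :: s) = edge_load b *+ 2 + slack s. Proof. by rewrite /slack big_cons. Qed.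

Ltac blT := rewrite ?cat_cons ?T_D ?T_O ?T_K ?slack_cons; atoms; bl.

Lemma sign_neq (u : relay) b : u.1.1 -> u.1 != (false, b).
Proof. by case: u => [[[] ?] ?]. Qed.

(** When both lists are odd, a single item and an odd item remain. The odd item is asked for a
    negative relay, which differs from the positive direct one; the price is one load on the edge to
    [x]. *)
Lemma node_even D O K E x : node D O K E -> ~~ odd (size D + size K) -> x \in D ++ O ->
  feasible 0 (items_total D O K E - slack (D ++ O) + edge_load x).
Proof.
move=> nd ev xDO; have [oK|eK] := boolP (odd (size K)); last first.
  have eD : ~~ odd (size D) by move: ev; rewrite oddD (negbTE eK) addbF.
  by apply: feasible_mono (node_base nd eD eK) _; atoms; bl.
have [ax bx] : adj w x /\ B x.
  case: nd => [[_ HD HO] _]; move: xDO; rewrite mem_cat => /orP[/HD[]|/HO[]] //.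
case: K oK nd ev => // k K oK; case: D xDO => [|d D] xDO nd; first by rewrite add0n oK.
move=> ev; have [[ad bb gd] nd1] := node_consD nd; have [[_ N3] nd2] := node_consK nd1.
have [u [iu su gu]] := N3 _ ax bx.
have eD : ~~ odd (size D) by move: ev oK => /=; lia.
have gb := node_base nd2 eD oK.
have := feasible_pair iu (relay_direct ad bb) (sign_neq d su) (feasible_join (feasible_join gd gu) gb).
rewrite -/(direct d) relay_load_dir => h; apply: feasible_mono h _; blT.
Qed.

(** The direct relay of [b] is delivered instead of paired. This spends two of the four loads on its
    edge, so the reserve can be kept on the same edge. *)
Lemma node_dlvD b D O K E : node (b :: D) O K E -> odd (size (b :: D) + size K) ->
  feasible 0 (items_total (b :: D) O K E - relay_load (direct b) - edge_load b).
Proof.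
move=> nd od; have [[ab bb gb] nd1] := node_consD nd; rewrite relay_load_dir.
have [oK|eK] := boolP (odd (size K)); last first.
  have eD : ~~ odd (size D) by move: od eK => /=; lia.
  by apply: (@feasible_slack _ _ (D ++ O)); apply: feasible_mono (feasible_join gb (node_base nd1 eD eK)) _; blT.
case: K oK nd nd1 od => // k K oK nd nd1 od.
case: D nd nd1 od => [|d D] nd nd1 od; first by move: od oK => /=; lia.
have [[ad bd' gd] nd2] := node_consD nd1; have [[_ N3] nd3] := node_consK nd2.
have [u [iu su gu]] := N3 _ ad bd'.
have eD : ~~ odd (size D) by move: od oK => /=; lia.
have := feasible_pair iu (relay_direct ad bd') (sign_neq d su)
  (feasible_join (feasible_join gd gu) (feasible_join gb (node_base nd3 eD oK))).
rewrite -/(direct d) relay_load_dir => h; apply: (@feasible_slack _ _ (D ++ O)); apply: feasible_mono h _; blT.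
Qed.

(** The double item [b] takes two chips: one direct relay is paired and the other is delivered. All
    four loads on its edge are spent, so the reserve has to sit on the edge to another item. *)
Lemma node_dlvO b D O K E : node D (b :: O) K E -> odd (size D + size K) ->
  D ++ O != [::] -> exists2 x, x \in D ++ O & feasible 0 (items_total D (b :: O) K E - relay_load (direct b) - edge_load x).
Proof.
move=> nd od ne; have [[ab bb _ gb] nd1 bn] := node_consO nd; rewrite relay_load_dir.
have dirP d D' : b \notin (d :: D') ++ O -> (direct b).1 != (direct d).1.
  by rewrite /= inE negb_or => /andP[h _]; rewrite xpair_eqE.
have [oK|eK] := boolP (odd (size K)); last first.
  case: D nd nd1 od ne bn => [|d D] nd nd1 od ne bn; first by move: od eK => /=; lia.
  have eD : ~~ odd (size D) by move: od eK => /=; lia.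
  have [[ad bd' gd] nd2] := node_consD nd1; exists d; first by rewrite mem_head.
  have := feasible_pair (relay_direct ab bb) (relay_direct ad bd') (dirP _ _ bn)
    (feasible_join gd (feasible_join gb (node_base nd2 eD eK))).
  rewrite -!/(direct _) !relay_load_dir => h; apply: (@feasible_slack _ _ (D ++ O)); apply: feasible_mono h _; blT.
case: K oK nd nd1 od => // k K oK nd nd1 od.
have [[_ N3] nd2] := node_consK nd1.
case: D nd nd1 nd2 od ne bn => [|d [|d2 D]] nd nd1 nd2 od ne bn.
- case: O nd nd1 nd2 ne bn {dirP} => // b2 O nd nd1 nd2 ne bn; exists b2; first by rewrite mem_head.
  have [[ab2 bb2 gb2 _] nd3 _] := node_consO nd2.
  have [u [iu su gu]] := N3 _ ab2 bb2.
  have := feasible_pair iu (relay_direct ab bb) (sign_neq b su)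
     (feasible_join (feasible_join gb gb2) (feasible_join gu (node_base nd3 isT oK))).
  rewrite -!/(direct _) !relay_load_dir => h; apply: (@feasible_slack _ _ O); apply: feasible_mono h _; blT.
- by move: od oK => /=; lia.
have eD : ~~ odd (size D) by move: od oK => /=; lia.
have [[ad bd' gd] nd3] := node_consD nd2; exists d; first by rewrite mem_head.
have [[ad2 bd2 gd2] nd4] := node_consD nd3.
have [u [iu su gu]] := N3 _ ad2 bd2.
have := feasible_pair iu (relay_direct ad2 bd2) (sign_neq d2 su)
   (feasible_pair (relay_direct ab bb) (relay_direct ad bd') (dirP _ _ bn)
     (feasible_join (feasible_join gb gd) (feasible_join gd2 (feasible_join gu (node_base nd4 eD oK))))).
rewrite -!/(direct _) !relay_load_dir => h; apply: (@feasible_slack _ _ (D ++ O)); apply: feasible_mono h _; blT.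
Qed.

(** With [b] as the only single or double item there is no other edge for the reserve. So [b] takes
    no chip here, and the relay of an odd item is passed on. *)
Lemma node_special_pass b K E : node [::] [:: b] K E -> odd (size K) ->
  exists k u, [/\ k \in K, relay_at w u, loc k u.1.2 & feasible 0 (items_total [::] [:: b] K E - relay_load u - edge_load b)].
Proof.
case: K => // k K nd oK; have [[[u [iu lu gu]] _] nd1] := node_consK nd.
exists k, u; split=> //; first by rewrite mem_head.
by apply: (@feasible_slack _ _ [::]); apply: feasible_mono (feasible_join gu (node_base nd1 isT oK)) _; rewrite /= ?slack_cons; blT.
Qed.

(** The other use of a lone double item: one of its direct relays is paired with that of an odd
    item, the other is delivered, and no reserve is left. The pair is nonzero because the origin of
    the odd item lies in [loc k] and [b] does not. *)
Lemma node_special_unreserved b K E : node [::] [:: b] K E -> odd (size K) ->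
  {in K, forall k, ~~ loc k b} -> feasible 0 (items_total [::] [:: b] K E - relay_load (direct b)).
Proof.
case: K => // k K nd oK nl; have [[[u [iu lu gu]] _] nd1] := node_consK nd.
have [[ab bb _ gb] nd2 _] := node_consO nd1; rewrite relay_load_dir.
have ne : u.1 != (direct b).1.
  by apply: contraL lu => /eqP ->; apply: nl; rewrite mem_head.
have := feasible_pair iu (relay_direct ab bb) ne (feasible_join (feasible_join gu gb) (node_base nd2 isT oK)).
rewrite -!/(direct _) !relay_load_dir => h; apply: (@feasible_slack _ _ [::]); apply: feasible_mono h _; rewrite /=; blT.
Qed.

(** The two additional relays of [b] are absorbed by two single items, by both relays of one double
    item, or by a single and an odd item. All of these have a different origin or the opposite
    sign. *)
Lemma node_double b D O K E : node D O K E -> ~~ odd (size D + size K) ->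
  adj w b -> B b -> b \notin D ++ O -> D ++ O != [::] ->
  feasible 0 (items_total D O K E + relay_load (direct b) *+ 2).
Proof.
move=> nd ev ab bb bn ne; rewrite relay_load_dir.
have dirP d s : b \notin d :: s -> (direct b).1 != (direct d).1.
  by rewrite /= inE negb_or => /andP[h _]; rewrite xpair_eqE.
have [oK|eK] := boolP (odd (size K)).
  case: K oK nd ev => // k K oK nd ev; have [[_ N3] nd1] := node_consK nd.
  case: D nd nd1 ev bn ne => [|d D] nd nd1 ev bn ne; first by move: ev oK => /=; lia.
  have eD : ~~ odd (size D) by move: ev oK => /=; lia.
  have [[ad bd' gd] nd2] := node_consD nd1.
  have [u [iu su gu]] := N3 _ ad bd'.
  have := feasible_pair (relay_direct ab bb) (relay_direct ad bd') (dirP _ _ bn)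
    (feasible_pair iu (relay_direct ab bb) (sign_neq b su) (feasible_join (feasible_join gd gu) (node_base nd2 eD oK))).
  rewrite -!/(direct _) !relay_load_dir => h; apply: (@feasible_slack _ _ (D ++ O)); apply: feasible_mono h _; blT.
have eD : ~~ odd (size D) by move: ev eK => /=; lia.
case: D nd ev bn ne eD => [|d [|d2 D]] // nd ev bn ne eD.
  case: O nd bn ne => // b1 O nd bn _; have [[ab1 bb1 _ gb1] nd1 _] := node_consO nd.
  have np : (direct b).1 != (direct b1).1 by apply: dirP bn.
  have := feasible_pair (relay_direct ab bb) (relay_direct ab1 bb1) np
    (feasible_pair (relay_direct ab bb) (relay_direct ab1 bb1) np (feasible_join gb1 (node_base nd1 isT eK))).
  rewrite -!/(direct _) !relay_load_dir => h; apply: (@feasible_slack _ _ O); apply: feasible_mono h _; blT.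
have [[ad bd1 gd] nd1] := node_consD nd; have [[ad2 bd2 gd2] nd2] := node_consD nd1.
have np : (direct b).1 != (direct d2).1.
  by rewrite xpair_eqE; move: bn; rewrite /= !inE !negb_or => /and3P[_ ->].
rewrite /= negbK in eD.
have := feasible_pair (relay_direct ab bb) (relay_direct ad bd1) (dirP _ _ bn)
    (feasible_pair (relay_direct ab bb) (relay_direct ad2 bd2) np (feasible_join (feasible_join gd gd2) (node_base nd2 eD eK))).
rewrite -!/(direct _) !relay_load_dir => h; apply: (@feasible_slack _ _ (D ++ O)); apply: feasible_mono h _; blT.
Qed.

(** The relay that stays unpaired goes into a form used once. Such a form takes a chip from its
    first origin only, so its second relay can be borrowed from free load on an edge at [w] or from
    an even item. A single item that is alone finds no partner here; that case is left to the
    hypothesis. *)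
Lemma node_root_odd D O K E : node D O K E -> odd (size D + size K) -> D ++ O != [::] ->
  (forall b, D = [:: b] -> O = [::] -> K = [::] -> E = [::] -> feasible 1 (child_budget b)) ->
  feasible 1 (items_total D O K E).
Proof.
move=> nd od ne; have [oK|eK] := boolP (odd (size K)).
  move=> _; case: K oK nd od => // k K oK nd od; have [[_ N3] nd1] := node_consK nd.
  have eD : ~~ odd (size D) by move: od oK => /=; lia.
  have [x xDO] : exists x, x \in D ++ O by case: (D ++ O) ne => // x s _; exists x; rewrite mem_head.
  have [ax bx] : adj w x /\ B x.
    case: nd => [[_ HD HO] _]; move: xDO; rewrite mem_cat => /orP[/HD[]|/HO[]] //.
  have [u [iu su gu]] := N3 _ ax bx.
  have := feasible_lin iu (relay_direct ax bx) (sign_neq x su) (feasible_join gu (feasible_slack_in xDO (node_base nd1 eD oK))).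
  rewrite -!/(direct _) !edges_load_dir => h.
  (* The load of [u] was provided twice and is spent once; dropping the rest is possible because
     loads are nonnegative. *)
  have [m mP] : exists m : nat, forall e, (edges_load u.2) (inr e) >= 0.
    by exists 0%N => e; rewrite /edges_load sum_ffunE sumr_ge0 // => ? _; rewrite ffunE.
  have l i : edges_load u.2 (inl i) = 0.
    by rewrite /edges_load sum_ffunE big1 // => ? _; rewrite ffunE.
  apply: feasible_mono h _; rewrite T_K /relay_load.
  move=> [i|e]; [have := l i|have := mP e]; move: {mP l} (edges_load u.2) => X; atoms; autorewrite with bud; [case: i => ?|]; blia.
case: D nd od ne => [|d D] nd od ne; first by move: od eK => /=; lia.
have eD : ~~ odd (size D) by move: od eK => /=; lia.
have [[ad bd1 gd] nd1] := node_consD nd.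
move=> last; have [[x xDO]|DO0] : (exists x, x \in D ++ O) \/ D ++ O = [::].
- by case: (D ++ O) => [|x s]; [right | left; exists x; rewrite mem_head].
- have [ax bx] : adj w x /\ B x.
    case: nd1 => [[_ HD HO] _]; move: xDO; rewrite mem_cat => /orP[/HD[]|/HO[]] //.
  have np : (direct d).1 != (direct x).1.
    rewrite xpair_eqE /=; apply/eqP => dx; case: nd => [[/= /andP[]]].
    by rewrite dx xDO.
  have := feasible_lin (relay_direct ad bd1) (relay_direct ax bx) np (feasible_join gd (feasible_slack_in xDO (node_base nd1 eD eK))).
  rewrite -!/(direct _) !edges_load_dir => h; apply: feasible_mono h _; blT.
have [D0 O0] : D = [::] /\ O = [::] by case: (D) (O) DO0 => // -[].
subst D O; case: K eK nd od nd1 last => [|k1 [|k2 K]] // eK nd od nd1 last.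
  case: E nd nd1 last => [|c E] nd nd1 last.
    by rewrite T_D /items_total /budget_sum !big_nil !addr0; apply: last.
  have [g0 [u [iu su gu]]] : even_item_spec c by case: nd => _ [_ _ _]; apply; rewrite mem_head.
  have gE : feasible 0 (budget_sum E).
    by apply: feasible_sum0 => x xE; case: nd => _ [_ _ _ /(_ x)]; rewrite inE xE orbT => /(_ isT)[].
  have := feasible_lin (relay_direct ad bd1) iu _ (feasible_join gd (feasible_join (gu _ ad bd1) gE)).
  rewrite -!/(direct _) !edges_load_dir eq_sym (sign_neq _ su) => /(_ isT) h.
  by apply: feasible_mono h _; rewrite /items_total /budget_sum !big_cons !big_nil -/(budget_sum E); atoms; bl.
have [[N1 N3] nd2] := node_consK nd1; have [[N1' N3'] nd3] := node_consK nd2.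
rewrite /= negbK in eK; have gb := node_base nd3 isT eK.
have [u1 [u2 [i1 i2 ne' g1 g2]]] : distinct_items k1 k2.
  case: nd1 => _ [/= /and3P[kn _ _] _ H _]; apply: H; rewrite ?inE ?eqxx ?orbT //.
  by apply: contraNneq kn => ->; rewrite mem_head.
(* The edge to [d] carries exactly four loads: one for the form used once, two for the pair of [d]
   with the negative relay of [k'], and one for the exit redirected on behalf of [k']. *)
have key k k' u : relay_at w u -> u.1 != (direct d).1 -> feasible 0 (child_budget k - relay_load u) ->
    (forall x, adj w x -> B x -> exists u, [/\ relay_at w u, u.1.1 & feasible 0 (child_budget k' + edge_load x - relay_load u)]) ->
    feasible 1 (child_budget d + child_budget k + child_budget k' + items_total [::] [::] K E).
  move=> iu nu gu M3; have [v [iv sv gv]] := M3 _ ad bd1.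
  have := feasible_lin iu (relay_direct ad bd1) nu
   (feasible_pair iv (relay_direct ad bd1) (sign_neq d sv) (feasible_join (feasible_join gd gu) (feasible_join gv gb))).
  rewrite -!/(direct _) !edges_load_dir !relay_load_dir => h.
  have mP e : (edges_load u.2) (inr e) >= 0.
    by rewrite /edges_load sum_ffunE sumr_ge0 // => ? _; rewrite ffunE.
  have l i : edges_load u.2 (inl i) = 0.
    by rewrite /edges_load sum_ffunE big1 // => ? _; rewrite ffunE.
  apply: (@feasible_slack _ _ [::]); apply: feasible_mono h _; rewrite /= /relay_load.
  move=> [i|e]; [have := l i|have := mP e]; move: {mP l} (edges_load u.2) => X; atoms; autorewrite with bud; [case: i => ?|]; blia.
rewrite T_D !T_K; have [e1|n1] := eqVneq u1.1 (direct d).1.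
  apply: feasible_mono (key k2 k1 u2 i2 _ g2 N3) _; first by rewrite -e1 eq_sym.
  by atoms; bl.
by apply: feasible_mono (key k1 k2 u1 i1 n1 g1 N3') _; atoms; bl.
Qed.

End Node.
End Budgets.
Hint Rewrite budD budN budMn bud0 cbE owE deE : bud.

(** * Induction along the link tree *)

Lemma split_or (T : eqType) (s : seq T) (P Q : T -> Prop) :
  {in s, forall x, P x \/ Q x} ->
  exists s1 s2, [/\ perm_eq s (s1 ++ s2), {in s1, forall x, P x} & {in s2, forall x, Q x}].
Proof.
elim: s => [|x s IH] H; first by exists [::], [::].
have [y ys|s1 [s2 [pe H1 H2]]] := IH; first by apply: H; rewrite inE ys orbT.
have [Px|Qx] := H x (mem_head _ _).
  by exists (x :: s1), s2; split=> //= [|y]; rewrite ?perm_cons // inE => /orP[/eqP ->|/H1].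
exists s1, (x :: s2); split=> // [|y]; last by rewrite inE => /orP[/eqP ->|/H2].
by rewrite perm_sym -[x :: s2]cat1s perm_catCA /= perm_cons perm_sym.
Qed.

Section Tree.
Variables (V : finType) (adj : rel V) (r : V) (p : V -> V) (d : V -> nat) (B : pred V).
Hypotheses (adj_sym : symmetric adj).
Hypothesis nt : normal_tree adj r p d.
Local Notation C := (connect adj r).
Local Notation "x ~< y" := (anc p d x y) (at level 70).
Hypothesis adjC : forall x y, adj x y -> C x.
Hypothesis Bspec : forall v, B v = ~~ [exists u, (adj v u && (v ~< u)) && B u].
Local Notation link := (link adj r p d B).
Local Notation needy := (needy adj p d B).
Local Notation B_nbrs := (B_nbrs adj B).
Local Notation free_nbrs := (free_nbrs adj r p d B).
Local Notation children := (children adj r p d B).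
Local Notation feasible := (feasible adj B).
Local Notation relay_at := (relay_at adj B).
Local Notation bud := (budget V).
Local Notation node := (node adj B).
Local Notation in_subtree := (in_subtree adj r p d B).

(* The edges inside the complement of [B] that are links get only 3 because the
   chain of forms of their lower end uses them once more. *)
Definition own_budget x : bud := if B x then 0 else \sum_(b in free_nbrs x) (edge_load x b *+ 4 + chip b).
Definition link_budget x : bud := if B x then edge_load x (link x) *+ 4 + chip x else
  if B (link x) then edge_load x (link x) *+ 4 + chip (link x) else edge_load x (link x) *+ 3 + exit_of x.
Definition subtree_budget v : bud := subtree_sum adj r p d B own_budget link_budget v.
Definition child_budget c : bud := link_budget c + subtree_budget c.

Lemma subtree_budget_rec v : C v -> subtree_budget v = own_budget v + \sum_(c in children v) child_budget c.
Proof. by move=> Cv; apply: (subtree_sum_rec B adj_sym nt adjC). Qed.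

Lemma edge_load_sym (x y : V) : edge_load x y = edge_load y x.
Proof. by rewrite /edge_load setUC. Qed.

Ltac gb := repeat match goal with
  | |- context [subtree_budget ?x] => move: (subtree_budget x) => ?
  | |- context [child_budget ?x] => move: (child_budget x) => ?
  | |- context [slack ?w ?x] => move: (slack w x) => ?
  | |- context [relay_load ?u] => move: (relay_load u) => ?
  | |- context [items_total ?b ?D ?O ?K ?E] => move: (items_total b D O K E) => ?
  | |- context [edge_load ?x ?y] => rewrite /edge_load
  end; rewrite ?/edges_load ?big_cons ?big_nil; move=> [[?|?]|?]; autorewrite with bud; blia.

(* Each vertex has one of two parities. An even needy vertex needs nothing from its
   parent, an odd one delivers a relay; the load subtracted on an edge [{c, x}] is
   the reserve for the exit of [c]. For a vertex [w] linked to [B], [piecej w] puts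
   [j] chips of [link w] on their edge; the unused loads in [piece0] and [piece1]
   allow one form [y_(link w) - y_b1] that is used once. *)
Definition good_in_B b := (feasible 0 (subtree_budget b) /\ (children b != set0 -> feasible 1 (subtree_budget b + chip b))) \/
  (feasible 0 (subtree_budget b + chip b) /\ feasible 0 (subtree_budget b - chip b)).
Definition even_needy c := exists2 b, b \in B_nbrs c & feasible 0 (subtree_budget c - edge_load c b).
Definition delivers c u := relay_at c u /\ exists2 x, x \in B_nbrs c & feasible 0 (subtree_budget c - relay_load u - edge_load c x).
(** The first two clauses serve to make the relays of two siblings different. The third one yields a
    negative relay at the parent; without a reserve, the exit of [c] has to be redirected through
    the parent. *)
Definition odd_needy c := [/\ exists2 u, delivers c u & c ~< u.1.2,
   (1 < #|B_nbrs c|)%N -> forall b, b \in B_nbrs c -> delivers c (direct c b) &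
   exists2 b, b \in B_nbrs c & delivers c (direct c b) \/ feasible 0 (subtree_budget c - relay_load (direct c b))].
Definition piece1 w := exists2 b1, b1 \in B_nbrs w :\ link w & feasible 0 (child_budget w - edge_load w (link w) - edge_load w b1).
Definition piece0 w := exists2 b1, b1 \in B_nbrs w :\ link w &
  feasible 0 (child_budget w - chip (link w) - edge_load w (link w) - edge_load w b1).
Definition piece2 w := feasible 0 (child_budget w + chip (link w)).

Definition good v := if B v then good_in_B v else if needy v then even_needy v \/ odd_needy v
  else piece1 v \/ (piece0 v /\ piece2 v).

Lemma NBP w b : b \in B_nbrs w -> adj w b /\ B b.
Proof. by rewrite inE => /andP. Qed.

Lemma relay_origin w u : relay_at w u -> B u.1.2 /\ C u.1.2.
Proof.
by elim=> //= {}w b wb Bb; split=> //; apply: (adjC (y := w)); rewrite adj_sym.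
Qed.

Definition pass c w (u : relay V) : relay V := (~~ u.1.1, u.1.2, [set c; w] :: u.2).

Lemma passU c w u : relay_at c u -> adj c w -> relay_at w (pass c w u).
Proof. by case: u => [[s b] S]; apply: relay_pass. Qed.

Lemma relay_load_pass c w u : relay_load (pass c w u) = relay_load u + edge_load c w *+ 2.
Proof. by rewrite /relay_load /= /edges_load big_cons mulrnDl -[chip _ + _ + _]addrA; congr (_ + _); rewrite addrC. Qed.

Lemma edges_load_pass c w u : edges_load (pass c w u).2 = edge_load c w + edges_load u.2.
Proof. by rewrite /edges_load big_cons. Qed.

(** * The items contributed by the children *)

Section AChildren.
Variables (w : V).
Hypothesis Bw : ~~ B w.

Lemma Achild c : c \in children w -> ~~ B c -> needy c /\ child_budget c = edge_load c w *+ 3 + exit_of c + subtree_budget c.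
Proof.
case/chP => Cc cr qc Bc; have nc : needy c.
  by apply/negPn/negP => /(link_piece adj_sym nt adjC Cc cr Bc); rewrite qc (negbTE Bw).
by split=> //; rewrite /child_budget /link_budget (negbTE Bc) qc (negbTE Bw).
Qed.

Lemma Bchild c : c \in children w -> B c -> child_budget c = edge_load w c *+ 4 + chip c + subtree_budget c.
Proof. by case/chP => Cc cr qc Bc; rewrite /child_budget /link_budget Bc qc edge_load_sym. Qed.

(** In the alternative use, the reserved load goes to a relay that is used once, and the exit leaves
    through [w] to [x]. The link then carries two of its three loads. *)
Lemma ev_item c : c \in children w -> ~~ B c -> even_needy c -> even_item_spec adj B w child_budget c.
Proof.
move=> cw Bc [b /NBP[cb' Bb] g]; rewrite /even_item_spec; have [nc ->] := Achild cw Bc.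
have wc := children_adj adj_sym nt adjC cw; have cw' : adj c w by rewrite adj_sym.
split.
  have := feasible_exit (relay_direct cb' Bb) g; rewrite -/(direct c b) edges_load_dir => h.
  by apply: feasible_mono h _; gb.
exists (pass c w (direct c b)); split=> //; first by apply: passU cw'; apply: relay_direct.
move=> x wx Bx; have := feasible_exit (passU (relay_direct wx Bx) wc) g.
rewrite !edges_load_pass -!/(direct _ _) !edges_load_dir (edge_load_sym w c) => h; apply: feasible_mono h _; gb.
Qed.

Lemma dlv_item c u : c \in children w -> ~~ B c -> delivers c u ->
  relay_at w (pass c w u) /\ feasible 0 (child_budget c - relay_load (pass c w u)).
Proof.
move=> cw Bc [iu [x /NBP[cx Bx] g]]; have [nc ->] := Achild cw Bc.
have cw' : adj c w by rewrite adj_sym; apply: (children_adj adj_sym nt adjC cw).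
split; first exact: passU.
have := feasible_exit (relay_direct cx Bx) g; rewrite -/(direct c x) edges_load_dir relay_load_pass => h.
by apply: feasible_mono h _; gb.
Qed.

(** If no load is reserved, the three loads of the link are used up: two by the relay, one by the
    exit on its way through [w] to [x]. *)
Lemma odd_item c : c \in children w -> ~~ B c -> odd_needy c -> odd_item_spec adj B w child_budget (anc p d) c.
Proof.
move=> cw Bc [[u du lu] _ [b bN N3]]; have [iu gu] := dlv_item cw Bc du.
split; first by exists (pass c w u).
have wc := children_adj adj_sym nt adjC cw; have cw' : adj c w by rewrite adj_sym.
move=> x wx Bx; exists (pass c w (direct c b)); have [cb' Bb] := NBP bN.
split=> //; first by apply: passU cw'; apply: relay_direct.
case: N3 => [/(dlv_item cw Bc)[_ g]|g]; first by apply: feasible_mono g _; gb.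
have [_ ->] := Achild cw Bc; have := feasible_exit (passU (relay_direct wx Bx) wc) g.
rewrite !edges_load_pass -!/(direct _ _) !edges_load_dir (edge_load_sym w c) relay_load_pass => h.
by apply: feasible_mono h _; gb.
Qed.

(** A child with two neighbours in [B] can choose an origin different from the other one's. If
    neither child has two, both are linked to their tree parent, so they are siblings in the normal
    tree, and their origins lie in disjoint branches. *)
Lemma odd_dist c c' : c \in children w -> ~~ B c -> odd_needy c -> c' \in children w -> ~~ B c' -> odd_needy c' ->
  c != c' -> distinct_items adj B w child_budget c c'.
Proof.
have key k k' : k \in children w -> ~~ B k -> odd_needy k -> k' \in children w -> ~~ B k' -> odd_needy k' ->
    (1 < #|B_nbrs k|)%N -> distinct_items adj B w child_budget k k'.
  move=> kw Bk [_ P _] kw' Bk' [[u du _] _ _] k2.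
  have [x xN xu] : exists2 x, x \in B_nbrs k & x != u.1.2.
    apply/exists_inP; rewrite -[X in is_true X]negbK negb_exists_in; apply/negP => /forall_inP H.
    move: k2; rewrite ltnNge => /negP; apply; rewrite -(cards1 u.1.2); apply: subset_leq_card.
    by apply/subsetP => y /H; rewrite negbK inE.
  have [i1 g1] := dlv_item kw Bk (P k2 x xN); have [i2 g2] := dlv_item kw' Bk' du.
  exists (pass k w (direct k x)), (pass k' w u); split=> //.
  by apply: contraNneq xu => -[_ ->].
move=> cw Bc oc cw' Bc' oc' ne; have [c2|c1] := ltnP 1 #|B_nbrs c|; first exact: key.
have [c2'|c1'] := ltnP 1 #|B_nbrs c'|.
  by have [u [u' [? ? h ? ?]]] := key _ _ cw' Bc' oc' cw Bc oc c2'; exists u', u; rewrite eq_sym.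
case/chP: (cw) => Cc cr qc; case/chP: (cw') => Cc' cr' qc'.
have [_ qp] := B_nbrs1_parent adj_sym nt adjC Bspec Cc cr Bc c1.
have [_ qp'] := B_nbrs1_parent adj_sym nt adjC Bspec Cc' cr' Bc' c1'.
case: oc oc' => [[u du lu] _ _] [[u' du' lu'] _ _].
have [i1 g1] := dlv_item cw Bc du; have [i2 g2] := dlv_item cw' Bc' du'.
exists (pass c w u), (pass c' w u'); split=> //.
apply: contraNneq ne => -[_ e]; apply/eqP; rewrite -e in lu'.
have [_ Cu] := relay_origin du.1.
by apply: (anc_sibling adj_sym nt.1 Cc Cc' Cu cr cr' _ lu lu'); rewrite -qp -qp' qc qc'.
Qed.

(* Leaf copies of the neighbours in [free_nbrs w] become items of their own. *)
Definition item_budget x : bud := if x \in children w then child_budget x else edge_load w x *+ 4 + chip x.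

(** The parity found for each child decides which kind of item it becomes. The last clause is kept
    for the root, where a single item that is alone must absorb the parity within its own
    subtree. *)
Lemma node_exists : C w -> {in children w, forall c, good c} ->
  exists D O K E, [/\ node w item_budget (anc p d) D O K E, items_total item_budget D O K E = subtree_budget w,
    D ++ O =i free_nbrs w :|: [set b in children w | B b],
    [/\ {subset O <= children w}, {subset K <= children w} & {subset children w <= D ++ O ++ K ++ E}] &
    {in D, forall b, b \in children w -> children b != set0 -> feasible 1 (subtree_budget b + chip b)}].
Proof.
move=> Cw Hg.
have [D [O [pDO HD HO]]] : exists s1 s2,
   [/\ perm_eq (enum [set b in children w | B b]) (s1 ++ s2),
     {in s1, forall b, feasible 0 (subtree_budget b) /\ (children b != set0 -> feasible 1 (subtree_budget b + chip b))} &
     {in s2, forall b, feasible 0 (subtree_budget b + chip b) /\ feasible 0 (subtree_budget b - chip b)}].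
  apply: split_or => b; rewrite mem_enum inE => /andP[/Hg + Bb].
  by rewrite /good Bb.
have [K [E [pKE HK HE]]] : exists s1 s2,
   [/\ perm_eq (enum [set b in children w | ~~ B b]) (s1 ++ s2),
     {in s1, forall b, odd_needy b} & {in s2, forall b, even_needy b}].
  apply: split_or => b; rewrite mem_enum inE => /andP[bw Bb].
  have [nb _] := Achild bw Bb; have := Hg b bw; rewrite /good (negbTE Bb) nb.
  by case; [right|left].
have DOch b : b \in D ++ O -> b \in children w /\ B b.
  by rewrite -(perm_mem pDO) mem_enum inE => /andP.
have KEch b : b \in K ++ E -> b \in children w /\ ~~ B b.
  by rewrite -(perm_mem pKE) mem_enum inE => /andP.
have bdwE c : c \in children w -> item_budget c = child_budget c by rewrite /item_budget => ->.
have NLn b : b \in free_nbrs w -> (b \in children w) = false.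
  rewrite !inE => /andP[_ /andP[/negbTE -> _]]; by rewrite !andbF.
have NLa b : b \in free_nbrs w -> adj w b /\ B b.
  by rewrite inE => /andP[/NBP].
have uDO : uniq (D ++ O) by rewrite -(perm_uniq pDO) enum_uniq.
have uKE : uniq (K ++ E) by rewrite -(perm_uniq pKE) enum_uniq.
have DP b : b \in D -> b \in children w /\ B b by move=> h; apply: DOch; rewrite mem_cat h.
have OP b : b \in O -> b \in children w /\ B b by move=> h; apply: DOch; rewrite mem_cat h orbT.
have KP b : b \in K -> b \in children w /\ ~~ B b by move=> h; apply: KEch; rewrite mem_cat h.
have EP b : b \in E -> b \in children w /\ ~~ B b by move=> h; apply: KEch; rewrite mem_cat h orbT.
exists (enum (free_nbrs w) ++ D), O, K, E; split.
- split; split.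
  + rewrite -catA cat_uniq enum_uniq uDO andbT /=; apply/hasPn => b /DOch[bw _] /=.
    by apply/negP; rewrite mem_enum => /NLn; rewrite bw.
  + move=> b; rewrite mem_cat mem_enum => /orP[bN|bD].
      have [wb Bb] := NLa _ bN; split=> //; rewrite /item_budget NLn //.
      by apply: feasible_mono (feasible_nil _ _) _; gb.
    have [bw Bb] := DP _ bD; split=> //; first exact: (children_adj adj_sym nt adjC bw).
    have [g _] := HD b bD; rewrite bdwE // Bchild //; apply: feasible_mono g _; gb.
  + move=> b bO; have [bw Bb] := OP _ bO; have [g1 g2] := HO b bO.
    split=> //; first exact: (children_adj adj_sym nt adjC bw); rewrite bdwE // Bchild //.
      by apply: feasible_mono g1 _; gb.
    by apply: feasible_mono g2 _; gb.
  + by move: uKE; rewrite cat_uniq => /and3P[].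
  + move=> k kK; have [kw Bk] := KP _ kK.
    by have := odd_item kw Bk (HK _ kK); rewrite /odd_item_spec !bdwE.
  + move=> k k' kK kK' ne; have [kw Bk] := KP _ kK; have [kw' Bk'] := KP _ kK'.
    by have := odd_dist kw Bk (HK _ kK) kw' Bk' (HK _ kK') ne; rewrite /distinct_items !bdwE.
  + move=> c cE; have [cw Bc] := EP _ cE.
    by have := ev_item cw Bc (HE _ cE); rewrite /even_item_spec !bdwE.
- have sb s : {subset s <= children w} -> budget_sum item_budget s = budget_sum child_budget s.
    by move=> sw; apply: eq_big_seq => x /sw /bdwE.
  rewrite /items_total (_ : budget_sum item_budget (enum (free_nbrs w) ++ D) = budget_sum item_budget (enum (free_nbrs w)) + budget_sum item_budget D); last first.
    by rewrite /budget_sum big_cat.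
  have -> : budget_sum item_budget D = budget_sum child_budget D by apply: sb => x /DP[].
  have -> : budget_sum item_budget O = budget_sum child_budget O by apply: sb => x /OP[].
  have -> : budget_sum item_budget K = budget_sum child_budget K by apply: sb => x /KP[].
  have -> : budget_sum item_budget E = budget_sum child_budget E by apply: sb => x /EP[].
  rewrite subtree_budget_rec // /own_budget (negbTE Bw) [X in _ = _ + X](bigID B) /= -!addrA; congr (_ + _).
    rewrite /budget_sum big_enum /=; apply: eq_bigr => b bN; by rewrite /item_budget NLn.
  rewrite addrA; congr (_ + _); rewrite /budget_sum -big_cat /=.
    by rewrite -(perm_big _ pDO) big_enum /=; apply: eq_bigl => x; rewrite inE.
  by rewrite -(perm_big _ pKE) big_enum /=; apply: eq_bigl => x; rewrite inE.
- by move=> b; rewrite -catA mem_cat mem_enum -(perm_mem pDO) mem_enum in_setU.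
- split.
  + by move=> b /OP[].
  + by move=> b /KP[].
  + move=> c cw; have [Bc|Bc] := boolP (B c).
      have : c \in D ++ O by rewrite -(perm_mem pDO) mem_enum inE cw.
      by rewrite mem_cat => /orP[] h; rewrite !mem_cat h ?orbT.
    have : c \in K ++ E by rewrite -(perm_mem pKE) mem_enum inE cw.
    by rewrite mem_cat => /orP[] h; rewrite !mem_cat h ?orbT.
move=> b; rewrite mem_cat mem_enum => /orP[/NLn ->|bD] // _.
by have [] := HD b bD.
Qed.
End AChildren.


Lemma node_deliver w D O K E b : node w (item_budget w) (anc p d) D O K E -> odd (size D + size K) ->
  b \in D ++ O -> (D = [::] -> O = [:: b] -> False) ->
  exists2 x, x \in D ++ O & feasible 0 (items_total (item_budget w) D O K E - relay_load (direct w b) - edge_load w x).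
Proof.
move=> nd od; rewrite mem_cat => /orP[bD _|bO ne].
  exists b; first by rewrite mem_cat bD.
  have [nd' ->] := node_perm (perm_to_rem bD) (perm_refl O) nd.
  by apply: (node_dlvD nd'); rewrite /= size_rem //; case: (D) bD od.
have [nd' ->] := node_perm (perm_refl D) (perm_to_rem bO) nd.
have [|x xDO g] := node_dlvO nd' od.
  apply/eqP => e; apply: ne; first by case: (D) e.
  have r0 : rem b O = [::] by case: (D) e.
  have := perm_to_rem bO; rewrite r0 => /perm_size /=; case: (O) bO => [|y [|]] //.
  by rewrite inE => /eqP ->.
by exists x => //; move: xDO; rewrite !mem_cat => /orP[->//|/mem_rem ->]; rewrite orbT.
Qed.

(** * Induction step at a vertex outside the independent set *)

Section AVertex.
Variables (w : V).
Hypotheses (Bw : ~~ B w) (Cw : C w) (Hch : {in children w, forall c, good c}).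

Lemma good_needy : needy w -> even_needy w \/ odd_needy w.
Proof.
move=> nw; have [D [O [K [E [nd TE DO [Och Kch _] _]]]]] := node_exists Bw Cw Hch.
have NBE : D ++ O =i B_nbrs w.
  move=> x; rewrite DO (B_nbrs_split adj_sym nt adjC Bspec Bw) [in RHS]in_setU.
  rewrite [x \in [set _ | _ & _]]inE; case: eqP => [->|]; last by rewrite orbF.
  by rewrite (negbTE (link_needy adj_sym nt adjC nw)) orbF.
have [b bN wb] := B_nbrs_low Bspec Bw.
have [od|ev] := boolP (odd (size D + size K)); last first.
  left; exists b => //; have bDO : b \in D ++ O by rewrite NBE.
  have g := node_even nd ev bDO; rewrite TE in g.
  have g' : feasible 0 (subtree_budget w + edge_load w b - slack w (D ++ O)) by apply: feasible_mono g _; gb.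
  by apply: feasible_mono (feasible_slack_in bDO g') _; gb.
right; have dl' x : x \in B_nbrs w -> (D = [::] -> O = [:: x] -> False) -> delivers w (direct w x).
  move=> xN ne; have [wx Bx] := NBP xN; split; first exact: relay_direct.
  have [|y yDO] := node_deliver nd od _ ne; first by rewrite NBE.
  by rewrite TE => g; exists y; rewrite -?NBE.
have P : (1 < #|B_nbrs w|)%N -> forall x, x \in B_nbrs w -> delivers w (direct w x).
  move=> c2 x xN; apply: dl' => // D0 Ox; move: c2; rewrite (eq_card (B := pred1 x)) ?card1 //.
  by move=> y; rewrite -NBE D0 Ox !inE.
have [/andP[/eqP D0 /eqP O1]|ne] := boolP ((D == [::]) && (O == [:: b])); last first.
  have db : delivers w (direct w b) by apply: dl' => // D0 O1; rewrite D0 O1 !eqxx in ne.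
  by split=> //; [exists (direct w b) | exists b; [|left]].
(* The only neighbour of [w] in [B] is a double item. The relay with a reserve then comes from an
   odd child, and the direct relay of [b] has no reserve. *)
rewrite D0 O1 in nd od TE; split=> //.
  have [k [u [kK iu ku g]]] := node_special_pass nd od.
  exists u; first by split=> //; exists b => //; rewrite -TE.
  by apply: (anc_trans (relay_origin iu).2 _ ku); apply: (children_anc adj_sym nt adjC); apply: Kch.
exists b => //; right; rewrite -TE; apply: (node_special_unreserved nd) => // k kK.
(* The child [b] is linked to its tree parent [w], so no other child [k] of [w] can lie between
   them. *)
have bch : b \in children w by apply: Och; rewrite O1 mem_head.
case/chP: (bch) => Cb br qb; have [wb' Bb] := NBP bN.
have [qp _] := link_B adj_sym nt adjC Bspec Cb br Bb.
have wk := children_anc adj_sym nt adjC (Kch _ kK).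
apply/negP => kb; have [kp|] := anc_step adj_sym nt.1 Cb kb.
  by move: wk; rewrite kp -qp qb anc_irr.
by rewrite -qp qb (anc_asym wk).
Qed.

(** If the number of relays is odd, [link w] joins as one more single item and makes it even, which
    gives [piece1]. If it is even, [link w] takes part with no relay or with two. *)
Lemma good_piece : w != r -> ~~ needy w -> piece1 w \/ (piece0 w /\ piece2 w).
Proof.
move=> wr nw; have [D [O [K [E [nd TE DO [Och Kch _] _]]]]] := node_exists Bw Cw Hch.
have Bq := link_piece adj_sym nt adjC Cw wr Bw nw.
have [wq qw Cq] := link_props B adj_sym nt adjC Cw wr.
have qDO : link w \notin D ++ O.
  rewrite DO !inE eqxx !andbF /=; apply/negP => /andP[/and3P[_ qr /eqP qqw] _].
  by have := link_d B adj_sym nt adjC Cq qr; have := link_d B adj_sym nt adjC Cw wr; rewrite qqw; lia.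
have NBE x : x != link w -> (x \in D ++ O) = (x \in B_nbrs w).
  move=> xq; rewrite DO (B_nbrs_split adj_sym nt adjC Bspec Bw) [in RHS]in_setU.
  by rewrite [x \in [set _ | _ & _]]inE (negbTE xq) orbF.
have [b bN wb] := B_nbrs_low Bspec Bw.
have bq : b != link w by apply: contraTneq wb => ->; rewrite (anc_asym qw).
have bDO : b \in D ++ O by rewrite NBE.
have bdE : child_budget w = edge_load w (link w) *+ 4 + chip (link w) + subtree_budget w by rewrite /child_budget /link_budget (negbTE Bw) Bq.
have b1 : b \in B_nbrs w :\ link w by rewrite in_setD1 bq.
have [od|ev] := boolP (odd (size D + size K)).
  left; exists b => //.
  have nch : (link w \in children w) = false.
    by apply/negP => qc; move: qDO; rewrite DO in_setU negb_or [in X in _ && X]inE qc Bq andbF.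
  have nd' : node w (item_budget w) (anc p d) (link w :: D) O K E.
    case: nd => [[u HD HO] H]; split=> //; split=> //; first by rewrite /= qDO.
    move=> x; rewrite inE => /orP[/eqP ->|/HD //]; split=> //.
    by rewrite /item_budget nch; apply: feasible_mono (feasible_nil _ _) _; gb.
  have ev : ~~ odd (size (link w :: D) + size K) by rewrite /= od.
  have g := node_even nd' ev (mem_head _ _).
  rewrite T_D TE /item_budget nch /= slack_cons in g.
  have g' : feasible 0 (child_budget w - edge_load w (link w) - slack w (D ++ O)) by apply: feasible_mono g _; rewrite bdE; gb.
  by apply: feasible_mono (feasible_slack_in bDO g') _; gb.
right; split.
  exists b => //; have g := node_even nd ev bDO; rewrite TE in g.
  have g' : feasible 0 (subtree_budget w + edge_load w b - slack w (D ++ O)) by apply: feasible_mono g _; gb.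
  by apply: feasible_mono (feasible_slack_in bDO g') _; rewrite bdE; gb.
have ne : D ++ O != [::] by case: (D ++ O) bDO.
have := node_double nd ev wq Bq qDO ne; rewrite TE relay_load_dir => g.
by apply: feasible_mono g _; rewrite /piece2 bdE; gb.
Qed.
End AVertex.

(** * Induction step at a vertex of the independent set *)

Section BVertex.
Variables (b : V).
Hypotheses (Bb : B b) (Cb : C b) (Hch : {in children b, forall c, good c}).

Lemma B_children : exists s1 s2, [/\ perm_eq (enum (children b)) (s1 ++ s2),
   {in s1, forall w, feasible 0 (child_budget w) /\ feasible 1 (child_budget w + chip b)},
   {in s2, forall w, [/\ feasible 0 (child_budget w - chip b), feasible 1 (child_budget w) & feasible 0 (child_budget w + chip b)]} &
   subtree_budget b = budget_sum child_budget s1 + budget_sum child_budget s2].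
Proof.
have H : {in enum (children b), forall w, (feasible 0 (child_budget w) /\ feasible 1 (child_budget w + chip b)) \/
   [/\ feasible 0 (child_budget w - chip b), feasible 1 (child_budget w) & feasible 0 (child_budget w + chip b)]}.
  move=> w; rewrite mem_enum => wb; have := Hch wb.
  case/chP: (wb) => Cw wr qw; have bw := children_adj adj_sym nt adjC wb.
  have wb' : adj w b by rewrite adj_sym.
  have Bw : ~~ B w by apply/negP => /(B_indep adj_sym nt adjC Bspec bw Bb).
  have nw : ~~ needy w by apply/negP => /(link_needy adj_sym nt adjC); rewrite qw Bb.
  rewrite /good (negbTE Bw) (negbTE nw) /piece1 /piece0 /piece2 qw.
  (* The loads left on the edges from [w] to [b] and [x] carry one form that is used once and gives
     a chip to [b]. *)
  have lin x a : x \in B_nbrs w :\ b -> feasible 0 a -> feasible 1 (a + chip b + edge_load w b + edge_load w x).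
    rewrite in_setD1 => /andP[xb /NBP[wx Bx]] g.
    have ne : (direct w b).1 != (direct w x).1 by rewrite xpair_eqE /= eq_sym.
    by have := feasible_lin (relay_direct wb' Bb) (relay_direct wx Bx) ne g; rewrite -!/(direct _ _) !edges_load_dir.
  case=> [[x xN g]|[[x xN g] g2]]; [left|right]; split=> //.
  - by apply: feasible_mono g _; gb.
  - by apply: feasible_mono (lin _ _ xN g) _; gb.
  - by apply: feasible_mono g _; gb.
  - by apply: feasible_mono (lin _ _ xN g) _; gb.
have [s1 [s2 [pe H1 H2]]] := split_or H; exists s1, s2; split=> //.
by rewrite subtree_budget_rec // /own_budget Bb add0r /budget_sum -big_cat /= -(perm_big _ pe) big_enum.
Qed.

(** In each pair, one child puts no chip of [b] on its edge and the other puts two, so the average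
    is the one chip provided per edge. *)
Lemma B_pairs (s : seq V) :
  {in s, forall w, [/\ feasible 0 (child_budget w - chip b), feasible 1 (child_budget w) & feasible 0 (child_budget w + chip b)]} ->
  ~~ odd (size s) -> feasible 0 (budget_sum child_budget s).
Proof.
have [m] := ubnP (size s); elim: m s => // m IH [|x [|y s]] //= lt H ev.
  by rewrite /budget_sum big_nil; apply: feasible_nil.
have [g1 _ _] := H x (mem_head _ _).
have [|_ _ g2] := H y; first by rewrite !inE eqxx orbT.
have g : feasible 0 (budget_sum child_budget s).
  apply: (IH s (ltnW lt)); last by rewrite negbK in ev.
  by move=> z zs; apply: H; rewrite !inE zs !orbT.
by apply: feasible_mono (feasible_join (feasible_join g1 g2) g) _; rewrite /budget_sum !big_cons -/(budget_sum child_budget s); move: (budget_sum child_budget s) => ?; gb.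
Qed.

(** What counts is the parity of the number of children with 0 or 2 chips. If it is odd, the last of
    them leaves one chip of [b] too many or too few, as desired. If it is even, everything balances,
    and a child allows an additional chip through a form used once. *)
Lemma good_B : good_in_B b /\ (feasible 0 (subtree_budget b) \/ feasible 1 (subtree_budget b)).
Proof.
rewrite /good_in_B; have [s1 [s2 [pe H1 H2 ->]]] := B_children.
have g1 : feasible 0 (budget_sum child_budget s1) by apply: feasible_sum0 => x /H1[].
have H2' x s : s2 = x :: s -> {in s, forall w, [/\ feasible 0 (child_budget w - chip b), feasible 1 (child_budget w) & feasible 0 (child_budget w + chip b)]}.
  by move=> e z zs; apply: H2; rewrite e inE zs orbT.
have [od|ev] := boolP (odd (size s2)).
  case: s2 od pe H2 H2' => // x s od pe H2 H2'; have gs := B_pairs (H2' x s erefl) od.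
  have [ga gb' gc] := H2 x (mem_head _ _).
  have -> : budget_sum child_budget (x :: s) = child_budget x + budget_sum child_budget s by rewrite /budget_sum big_cons.
  split; [right; split|right].
  - apply: feasible_mono (feasible_join (feasible_join gc gs) g1) _; move: (budget_sum child_budget s) (budget_sum child_budget s1) => ? ?; gb.
  - apply: feasible_mono (feasible_join (feasible_join ga gs) g1) _; move: (budget_sum child_budget s) (budget_sum child_budget s1) => ? ?; gb.
  apply: feasible_mono (feasible_join (feasible_join gb' gs) g1) _; move: (budget_sum child_budget s) (budget_sum child_budget s1) => ? ?; gb.
have g2 := B_pairs H2 ev; have g12 := feasible_join g1 g2.
split; [left; split=> //|by left] => ne.
case: s2 ev pe H2 H2' {g12} g2 => [|x [|y s]] // ev pe H2 H2' g2.
  case: s1 pe H1 g1 => [|x s] pe H1 g1.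
    by move: ne; rewrite -card_gt0 cardE (perm_size pe).
  have [_ gx] := H1 x (mem_head _ _).
  have gs : feasible 0 (budget_sum child_budget s) by apply: feasible_sum0 => z zs; have [] := H1 z; rewrite ?inE ?zs ?orbT.
  apply: feasible_mono (feasible_join gx gs) _; rewrite /budget_sum big_cons big_nil -/(budget_sum child_budget s).
  by move: (budget_sum child_budget s) => ?; gb.
have [_ gx _] := H2 x (mem_head _ _).
have [|_ _ gy] := H2 y; first by rewrite !inE eqxx orbT.
rewrite /= negbK in ev.
have gs : feasible 0 (budget_sum child_budget s).
  by apply: B_pairs ev => z zs; apply: (H2' x (y :: s)); rewrite // inE zs orbT.
apply: feasible_mono (feasible_join (feasible_join gx gy) (feasible_join gs g1)) _; rewrite /budget_sum !big_cons -/(budget_sum child_budget s) -/(budget_sum child_budget s1).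
by move: (budget_sum child_budget s) (budget_sum child_budget s1) => ? ?; gb.
Qed.
End BVertex.

(** * The whole tree and its root *)

Lemma good_all v : C v -> v != r -> good v.
Proof.
pose M := (\max_x d x)%N; have dM x : (d x <= M)%N by apply: leq_bigmax.
have [m] := ubnP (M - d v)%N; elim: m v => // m IH v lt Cv vr.
have Hch : {in children v, forall c, good c}.
  move=> c cv; case/chP: (cv) => Cc cr _; apply: IH => //.
  by have := children_d adj_sym nt adjC cv; have := dM c; lia.
rewrite /good; have [Bv|Bv] := boolP (B v); first by have [] := good_B Bv Cv Hch.
by case: ifP => nv; [apply: good_needy | apply: good_piece => //; rewrite nv].
Qed.

Lemma sub_child v x : C v -> in_subtree v x -> x != v -> exists2 c, c \in children v & in_subtree c x.
Proof.
move=> Cv sx xv; have := sum_ch_sub B adj_sym nt adjC x Cv; rewrite sx xv /=.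
move=> s1; apply/exists_inP; rewrite -[X in is_true X]negbK negb_exists_in; apply/negP => /forall_inP H.
by move: s1; rewrite big1 // => c /H /negbTE ->.
Qed.

Lemma root_realizable : (forall b, exists x, [/\ C x, x != r & x != b]) ->
  exists2 k, (k <= 1)%N & feasible k (subtree_budget r).
Proof.
move=> nK2; have Cr : C r by apply: connect0.
have Hch : {in children r, forall c, good c} by move=> c /chP[Cc cr _]; apply: good_all.
have [Br|Br] := boolP (B r).
  by have [_ [g|g]] := good_B Br Cr Hch; [exists 0%N | exists 1%N].
have [D [O [K [E [nd TE DO [Och Kch all] lin]]]]] := node_exists Br Cr Hch.
have NBE : D ++ O =i B_nbrs r.
  move=> x; rewrite DO (B_nbrs_split adj_sym nt adjC Bspec Br) [in RHS]in_setU.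
  by rewrite [x \in [set _ | _ & _]]inE eqxx !andbF orbF.
have [b bN _] := B_nbrs_low Bspec Br; have bDO : b \in D ++ O by rewrite NBE.
have [od|ev] := boolP (odd (size D + size K)); last first.
  exists 0%N => //; have g := node_even nd ev bDO; rewrite TE in g.
  have g' : feasible 0 (subtree_budget r + edge_load r b - slack r (D ++ O)) by apply: feasible_mono g _; gb.
  by apply: feasible_mono (feasible_slack_in bDO g') _; gb.
exists 1%N => //; rewrite -TE; apply: (node_root_odd nd) => //; first by case: (D ++ O) bDO.
(* The root has [x] as its only child. The component has a third vertex, so [x] has children of its
   own and its subtree can absorb the chip with a form used once. *)
move=> x D1 O0 K0 E0.
have onlyx c : c \in children r -> c = x by move/all; rewrite D1 O0 K0 E0 inE => /eqP.
have [y [Cy yr yx]] := nK2 x.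
have sr z : C z -> in_subtree r z by rewrite (sub_root B adj_sym nt adjC).
have [c cr scy] := sub_child Cr (sr _ Cy) yr; have cx := onlyx _ cr; subst c.
rewrite /item_budget cr; case/chP: (cr) => Cx xr qx.
have [c cx _] := sub_child Cx scy yx.
have Bx : B x by have := NBE x; rewrite D1 O0 mem_head => /esym/NBP[].
rewrite (Bchild cr Bx); have g : feasible 1 (subtree_budget x + chip x).
  by apply: lin cr _; [rewrite D1 mem_head | apply/set0Pn; exists c].
by apply: feasible_mono g _; gb.
Qed.

End Tree.

(** * From derivations of feasibility to lists of forms *)

Section FormLists.
Variables (V : finType) (adj : rel V) (B : pred V).
Local Notation form := (relay V * relay V)%type.

Definition form_ok (f : form) := exists w, [/\ relay_at adj B w f.1, relay_at adj B w f.2 & f.1.1 != f.2.1].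

Lemma feasible_lists k (a : budget V) : feasible adj B k a ->
  exists (ls F : seq form) (X : seq (V * relay V)),
  [/\ size ls = k, {in ls, forall f, form_ok f}, {in F, forall f, form_ok f},
      {in X, forall x, relay_at adj B x.1 x.2} &
   ble (\sum_(f <- F) (relay_load f.1 + relay_load f.2) + \sum_(f <- ls) (chip f.1.1.2 + edges_load f.1.2 + edges_load f.2.2)
        + \sum_(x <- X) (exit_of x.1 + edges_load x.2.2)) a].
Proof.
have consP (T : eqType) (P : T -> Prop) x s :
    P x -> {in s, forall y, P y} -> {in x :: s, forall y, P y}.
  by move=> Px Ps y; rewrite inE => /orP[/eqP ->|/Ps].
elim=> {k a} [|k a w u1 u2 i1 i2 ne _|k a y u iu _|k a w u1 u2 i1 i2 ne _|k a b _].
- by exists [::], [::], [::]; split=> //; rewrite !big_nil => -[[?|?]|?]; autorewrite with bud; blia.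
- case=> ls [F [X [sz hl hF hX le]]]; exists ls, ((u1, u2) :: F), X; split=> //.
    by apply: consP => //; exists w.
  move: le; rewrite big_cons /=; set x := (\sum_(_ <- _) _ : budget V); set y := (\sum_(_ <- _) _ : budget V).
  set z := (\sum_(_ <- _) _ : budget V); move: x y z (relay_load u1) (relay_load u2) => x y z x1 x2 le.
  by move=> i; have := le i; case: i => ?; autorewrite with bud; blia.
- case=> ls [F [X [sz hl hF hX le]]]; exists ls, F, ((y, u) :: X); split=> //.
    exact: consP.
  move: le; rewrite big_cons /=; set x := (\sum_(_ <- _) _ : budget V); set y' := (\sum_(_ <- _) _ : budget V).
  set z := (\sum_(_ <- _) _ : budget V); move: x y' z (exit_of y) (edges_load u.2) => x y' z x1 x2 le.
  by move=> i; have := le i; case: i => ?; autorewrite with bud; blia.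
- case=> ls [F [X [sz hl hF hX le]]]; exists ((u1, u2) :: ls), F, X; split=> //=.
    by rewrite sz.
    by apply: consP => //; exists w.
  move: le; rewrite big_cons /=; set x := (\sum_(_ <- _) _ : budget V); set y' := (\sum_(_ <- _) _ : budget V).
  set z := (\sum_(_ <- _) _ : budget V); move: x y' z (chip u1.1.2) (edges_load u1.2) (edges_load u2.2) => x y' z x1 x2 x3 le.
  by move=> i; have := le i; case: i => ?; autorewrite with bud; blia.
case=> ls [F [X [sz hl hF hX le]]] le'; exists ls, F, X; split=> // i.
by have := le i; have := le' i; case: i => ? h1 h2; [rewrite h2 | apply: le_trans h2 h1].
Qed.

Lemma edges_load_inr S e : edges_load S (inr e : V + V + {set V}) = Posz (count_mem e S).
Proof.
elim: S => [|x S IH]; first by rewrite /edges_load big_nil bud0.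
by rewrite /edges_load big_cons -/(edges_load S) budD IH deE /= PoszD.
Qed.

Lemma edges_load_inl S i : edges_load S (inl i : V + V + {set V}) = 0.
Proof.
elim: S => [|x S IH]; first by rewrite /edges_load big_nil bud0.
by rewrite /edges_load big_cons -/(edges_load S) budD IH deE.
Qed.

Lemma relay_load_chip (u : relay V) v : relay_load u (inl (inl v)) = Posz (u.1.2 == v).
Proof. by rewrite /relay_load budD budMn edges_load_inl mul0rn addr0 cbE. Qed.

Lemma relay_load_edge (u : relay V) e : relay_load u (inr e) = Posz (2 * count_mem e u.2).
Proof. by rewrite /relay_load budD budMn edges_load_inr cbE add0r mulr2n mul2n -addnn PoszD. Qed.

Lemma relay_load_own (u : relay V) v : relay_load u (inl (inr v)) = 0.
Proof. by rewrite /relay_load budD budMn edges_load_inl mul0rn addr0 cbE. Qed.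

Lemma assoc_fun (T : eqType) (X : seq (V * T)) (t0 : T) : uniq (map fst X) ->
  exists f : V -> T, {in X, forall x, f x.1 = x.2}.
Proof.
elim: X => [|x X IH] /=; first by exists (fun=> t0).
case/andP => nx /IH[f Hf]; exists (fun v => if v == x.1 then x.2 else f v) => y.
rewrite inE => /orP[/eqP ->|yX]; first by rewrite eqxx.
case: eqP => [e|_]; last exact: Hf.
by case/negP: nx; rewrite -e; apply: map_f.
Qed.
End FormLists.

(** * The total budget and the forms it pays for *)

Section Totals.
Variables (V : finType) (adj : rel V) (r : V) (p : V -> V) (d : V -> nat) (B : pred V).
Hypotheses (adj_sym : symmetric adj).
Hypothesis nt : normal_tree adj r p d.
Local Notation C := (connect adj r).
Local Notation "x ~< y" := (anc p d x y) (at level 70).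
Hypothesis adjC : forall x y, adj x y -> C x.
Hypothesis Bspec : forall v, B v = ~~ [exists u, (adj v u && (v ~< u)) && B u].
Local Notation link := (link adj r p d B).
Local Notation needy := (needy adj p d B).
Local Notation B_nbrs := (B_nbrs adj B).
Local Notation free_nbrs := (free_nbrs adj r p d B).
Local Notation bud := (budget V).

Lemma A_C w : ~~ B w -> C w.
Proof. by case/(B_low Bspec) => b [/adjC]. Qed.

Lemma sum_NB (M : zmodType) (F : V -> V -> M) :
  \sum_(w | ~~ B w) \sum_(b in B_nbrs w) F w b = \sum_(w | ~~ B w) \sum_(b in free_nbrs w) F w b +
    (\sum_(x | [&& C x, x != r & B x]) F (link x) x +
     \sum_(x | [&& C x, x != r, ~~ B x & B (link x)]) F x (link x)).
Proof.
rewrite [X in _ = _ + (X + _)](partition_big link (predC B)) /=; last first.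
  by move=> x /and3P[Cx xr Bx]; have [] := link_B adj_sym nt adjC Bspec Cx xr Bx.
have -> : \sum_(x | [&& C x, x != r, ~~ B x & B (link x)]) F x (link x) =
    \sum_(w | ~~ B w) (if (w != r) && B (link w) then F w (link w) else 0).
  rewrite [LHS]big_mkcond [RHS]big_mkcond /=; apply: eq_bigr => x _.
  by case: (boolP (B x)) => [|/A_C ->] /=; rewrite ?andbF.
rewrite -!big_split /=; apply: eq_bigr => w Bw.
rewrite [LHS](bigID (fun b => link b == w)) /= [X in _ + X = _](bigID (fun b => link w != b)) /=.
rewrite addrCA; congr (_ + (_ + _)).
- apply: eq_big => [b|b /andP[_ /eqP ->] //].
  symmetry; apply/idP/idP => [/andP[/and3P[Cb br Bb] qb]|/andP[+ qb]].
    rewrite inE Bb qb !andbT adj_sym -(eqP qb).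
    by have [] := link_props B adj_sym nt adjC Cb br.
  rewrite inE => /andP[wb Bb]; rewrite Bb qb !andbT (adjC (y := w)) 1?adj_sym //=.
  by apply: contraNneq Bw => br; rewrite -(eqP qb) br link_root -br.
- by apply: eq_bigl => b; rewrite [RHS]inE -andbA.
case: (boolP (w != r)) => [wr|/negPn/eqP wr] /=; last first.
  rewrite big1 // => b /andP[/andP[bN _]]; rewrite wr link_root negbK => /eqP rb.
  by move: bN; rewrite inE -rb -wr (negbTE Bw) andbF.
have [wq qw Cq] := link_props B adj_sym nt adjC (A_C Bw) wr.
case: (boolP (B (link w))) => Bq; last first.
  rewrite big1 // => b /andP[/andP[bN _]]; rewrite negbK => /eqP qb.
  by move: bN; rewrite inE -qb (negbTE Bq) andbF.
rewrite (big_pred1 (link w)) // => b; rewrite negbK [link w == b]eq_sym /=.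
have [->|] := eqVneq b (link w); rewrite ?andbF // andbT.
rewrite inE wq Bq /=; apply/eqP => qqw.
have [qr|qr] := eqVneq (link w) r; first by move: wr; rewrite -qqw qr link_root eqxx.
by have := link_d B adj_sym nt adjC Cq qr; have := link_d B adj_sym nt adjC (A_C Bw) wr; rewrite qqw; lia.
Qed.

(** Every edge at [B] contributes one chip to its end in [B]. As [B] is independent, each [b] owns
    [deg b] chips, the exponent needed in the coefficient. *)
Lemma subtree_budget_total : subtree_budget adj r p d B r = \sum_(w | ~~ B w) \sum_(b in B_nbrs w) (edge_load w b *+ 4 + chip b)
  + \sum_(x | needy x) (edge_load x (link x) *+ 3 + exit_of x).
Proof.
rewrite /subtree_budget (subtree_sum_root B adj_sym nt adjC).
pose F w b : bud := edge_load w b *+ 4 + chip b; pose H x : bud := edge_load x (link x) *+ 3 + exit_of x.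
have -> : \sum_(x | C x) own_budget adj r p d B x = \sum_(w | ~~ B w) \sum_(b in free_nbrs w) F w b.
  rewrite [LHS]big_mkcond [RHS]big_mkcond /=; apply: eq_bigr => x _; rewrite /own_budget.
  by case: (boolP (B x)) => [|/A_C ->] //=; rewrite if_same.
have -> : \sum_(x | C x && (x != r)) link_budget adj r p d B x =
    \sum_(x | [&& C x, x != r & B x]) F (link x) x +
    (\sum_(x | [&& C x, x != r, ~~ B x & B (link x)]) F x (link x) + \sum_(x | needy x) H x).
  rewrite (bigID B) /= [X in _ + X](bigID (fun x => B (link x))) /=; congr (_ + (_ + _)).
  - apply: eq_big => x; first by rewrite andbA.
    by case/andP => _ Bx; rewrite /link_budget Bx edge_load_sym.
  - apply: eq_big => x; first by rewrite -!andbA.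
    by case/andP => /andP[_ Bx] Bq; rewrite /link_budget (negbTE Bx) Bq.
  apply: eq_big => x.
    apply/idP/idP => [/andP[/andP[/andP[Cx xr] Bx] Bq]|nx].
      by apply/negPn/negP => /(link_piece adj_sym nt adjC Cx xr Bx) h; rewrite h in Bq.
    rewrite (needyC adjC nx) (needy_r adj_sym nt adjC nx) (link_needy adj_sym nt adjC nx) andbT.
    by case/andP: nx.
  by case/andP => /andP[_ /negbTE Bx] /negbTE Bq; rewrite /link_budget Bx Bq.
rewrite addrA addrA; congr (_ + _).
by rewrite sum_NB addrA.
Qed.

Definition AB_cols := [seq (b, w) | w <- enum [pred w | ~~ B w], b <- enum (B_nbrs w)].

Lemma forms_exist : (forall b, exists x, [/\ C x, x != r & x != b]) ->
  exists (ls F : seq (relay V * relay V)) (ex : V -> relay V),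
  [/\ (size ls <= 1)%N, {in ls ++ F, forall f, form_ok adj B f},
      (forall y, needy y -> relay_at adj B y (ex y)),
      perm_eq ([seq f.1.1.2 | f <- ls ++ F] ++ [seq f.2.1.2 | f <- F]) (map fst AB_cols) &
      forall e, (2 * count_mem e (flatten [seq f.1.2 ++ f.2.2 | f <- F]) +
         count_mem e (flatten [seq f.1.2 ++ f.2.2 | f <- ls]) +
         \sum_(y | needy y) count_mem e (ex y).2 <=
         4 * count_mem e [seq [set c.2; c.1] | c <- AB_cols] +
         3 * \sum_(y | needy y) ([set y; link y] == e))%N].
Proof.
move=> nK2; have [k k1 g] := root_realizable adj_sym nt adjC Bspec nK2.
have [ls [F [X [sz hl hF hX le]]]] := feasible_lists g; move: g => _.
have sE (T : Type) (s : seq T) (f : T -> bud) i : (\sum_(x <- s) f x) i = \sum_(x <- s) f x i.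
  by rewrite sum_ffunE.
have sE' (P : pred V) (f : V -> bud) i : (\sum_(x | P x) f x) i = \sum_(x | P x) f x i.
  by rewrite sum_ffunE.
have PS (T : Type) (s : seq T) (P : pred T) (f : T -> nat) :
    \sum_(x <- s | P x) Posz (f x) = Posz (\sum_(x <- s | P x) f x)%N.
  by rewrite (big_morph Posz PoszD (erefl (Posz 0))).
have cE (T : eqType) (s : seq T) x : count_mem x s = (\sum_(y <- s) (y == x))%N.
  by elim: s => [|y s IH]; rewrite ?big_nil ?big_cons //= IH.
have ABE (f : V -> V -> int) : \sum_(w | ~~ B w) \sum_(b in B_nbrs w) f w b = \sum_(c <- AB_cols) f c.2 c.1.
  rewrite /AB_cols big_allpairs_dep /= big_enum /=; apply: eq_bigr => w _; by rewrite big_enum.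
(* Both sides are compared at one coordinate, in natural numbers: an equality for chips and exits,
   an inequality for loads. *)
have ev i (a b : _ -> nat) (c : _ -> nat) (g : V -> V -> nat) (h : V -> nat) :
    (forall f, (relay_load f.1 + relay_load f.2) i = Posz (a f)) ->
    (forall f, (chip f.1.1.2 + edges_load f.1.2 + edges_load f.2.2) i = Posz (b f)) ->
    (forall x, (exit_of x.1 + edges_load x.2.2) i = Posz (c x)) ->
    (forall w x, (edge_load w x *+ 4 + chip x) i = Posz (g w x)) ->
    (forall x, (edge_load x (link x) *+ 3 + exit_of x) i = Posz (h x)) ->
    let s := (\sum_(f <- F) a f + \sum_(f <- ls) b f + \sum_(x <- X) c x)%N in
    let t := (\sum_(e <- AB_cols) g e.2 e.1 + \sum_(x | needy x) h x)%N in
    if i is inr _ then (s <= t)%N : Prop else s = t.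
  move=> ea eb ec eg eh s t.
  have e1 : Posz s = (\sum_(f <- F) (relay_load f.1 + relay_load f.2) +
      \sum_(f <- ls) (chip f.1.1.2 + edges_load f.1.2 + edges_load f.2.2) + \sum_(x <- X) (exit_of x.1 + edges_load x.2.2)) i.
    rewrite !budD !sE /s !PoszD -!PS; congr (_ + _ + _); apply: eq_bigr => x _; first by rewrite ea.
      by rewrite eb.
    by rewrite ec.
  have e2 : Posz t = subtree_budget adj r p d B r i.
    rewrite subtree_budget_total budD !sE' /t PoszD -!PS; congr (_ + _); last by apply: eq_bigr => x _; rewrite eh.
    rewrite -(ABE (fun w b => Posz (g w b))); apply: eq_bigr => w _; rewrite sE'.
    by apply: eq_bigr => y _; rewrite eg.
  have := le i; rewrite -e1 -e2; case: (i) => _; last by rewrite lez_nat.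
  by case.
have chips v : (\sum_(f <- F) ((f.1.1.2 == v) + (f.2.1.2 == v)) + \sum_(f <- ls) (f.1.1.2 == v)
     = \sum_(c <- AB_cols) (c.1 == v))%N.
  have /= := ev (inl (inl v)) (fun f => (f.1.1.2 == v) + (f.2.1.2 == v))%N
    (fun f => f.1.1.2 == v : nat) (fun=> 0%N) (fun _ x => x == v : nat) (fun=> 0%N).
  rewrite !big1_eq !addn0; apply.
  - by move=> f; rewrite budD !relay_load_chip.
  - by move=> f; rewrite !budD !edges_load_inl cbE !addr0.
  - by move=> x; rewrite !budD !edges_load_inl owE.
  - by move=> w x; rewrite budD budMn cbE deE mul0rn add0r.
  by move=> x; rewrite budD budMn owE deE mul0rn add0r.
have owners v : (\sum_(x <- X) (x.1 == v) = needy v)%N.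
  have /= := ev (inl (inr v)) (fun=> 0%N) (fun=> 0%N) (fun x => x.1 == v : nat) (fun _ _ => 0%N)
     (fun x => x == v : nat).
  rewrite !big1_eq !add0n => ->.
  - rewrite -big_mkcondr /=; case: (boolP (needy v)) => nv.
      by rewrite (big_pred1 v) // => x /=; case: eqP => [->|]; rewrite ?nv ?andbF.
    by rewrite big_pred0 // => x /=; case: eqP => [->|]; rewrite ?(negbTE nv) ?andbF.
  - by move=> f; rewrite budD !relay_load_own.
  - by move=> f; rewrite !budD !edges_load_inl cbE !addr0.
  - by move=> x; rewrite !budD !edges_load_inl owE addr0.
  - by move=> w x; rewrite budD budMn cbE deE mul0rn add0r.
  by move=> x; rewrite budD budMn owE deE mul0rn add0r.
have edges e := ev (inr e) (fun f => 2 * (count_mem e f.1.2 + count_mem e f.2.2))%N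
    (fun f => count_mem e f.1.2 + count_mem e f.2.2)%N (fun x => count_mem e x.2.2)
    (fun w x => 4 * ([set w; x] == e))%N (fun x => 3 * ([set x; link x] == e))%N.
have ownX v : count_mem v (map fst X) = needy v by rewrite cE big_map owners.
have memX v : (v \in map fst X) = needy v.
  by rewrite -has_pred1 has_count ownX; case: (needy v).
have uX : uniq (map fst X) by apply: count_mem_uniq => v; rewrite ownX memX.
have pX : perm_eq (map fst X) (enum needy).
  apply: uniq_perm; rewrite ?enum_uniq // => v.
  by rewrite mem_enum memX.
have [ex exE] := assoc_fun (false, r, [::]) uX.
exists ls, F, ex; split.
- by rewrite sz.
- by move=> f; rewrite mem_cat => /orP[/hl|/hF].
- move=> y ny; have /mapP[x xX ->] : y \in map fst X by rewrite memX.
  by rewrite exE //; apply: hX.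
- apply/allP => v _ /=; apply/eqP; rewrite count_cat map_cat count_cat !cE !big_map.
  by rewrite -chips big_split /= -addnA addnC.
move=> e; have := edges e; rewrite /= -!big_distrr /=.
rewrite [\sum_(y | needy y) count_mem e (ex y).2](_ : _ = \sum_(x <- X) count_mem e x.2.2)%N; last first.
  rewrite -big_enum -(perm_big _ pX) big_map /=; apply: eq_big_seq => x xX; by rewrite exE.
have cF (s : seq (relay V * relay V)) : count_mem e (flatten [seq f.1.2 ++ f.2.2 | f <- s]) =
   (\sum_(f <- s) (count_mem e f.1.2 + count_mem e f.2.2))%N.
  by elim: s => [|f s IH]; rewrite ?big_nil //= big_cons !count_cat IH.
rewrite !cF cE big_map => h; apply: h.
- by move=> f; rewrite budD !relay_load_edge mulnDr.
- by move=> f; rewrite !budD !edges_load_inr cbE add0r.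
- by move=> f; rewrite !budD !edges_load_inr owE add0r.
- by move=> w x; rewrite budD budMn deE cbE; lia.
by move=> x; rewrite budD budMn deE owE; lia.
Qed.
End Totals.

(* Imported only here because it redefines [symmetric]. *)
From mathcomp Require Import mpoly.

(** * Permanents and certificates *)

Lemma perm_eq_rem (T : eqType) (c : T) (s t : seq T) :
  perm_eq s t -> perm_eq (rem c s) (rem c t).
Proof.
move=> st; have [cs|cns] := boolP (c \in s); last first.
  by rewrite !rem_id // -(perm_mem st).
rewrite -(perm_cons c) -(permPl (perm_to_rem cs)) (perm_trans st) //.
by apply: perm_to_rem; rewrite -(perm_mem st).
Qed.

Section Permanent.
Variable T : eqType.
Implicit Types (rs : seq (T -> int)) (cs : seq T).

(** The permanent, expanded along the first row. Columns form a list so that they may repeat; [rem]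
    deletes one copy. *)
Fixpoint per rs cs : int :=
  if rs is r :: rs' then \sum_(c <- cs) r c * per rs' (rem c cs) else 1.

Lemma per_perm rs cs cs' : perm_eq cs cs' -> per rs cs = per rs cs'.
Proof.
elim: rs cs cs' => //= r rs IH cs cs' pcs.
rewrite (perm_big cs') //=; apply: eq_bigr => c _; congr (_ * _).
by apply: IH; apply: perm_eq_rem.
Qed.

Lemma eq_per rs rs' cs :
  size rs = size rs' ->
  (forall i c, (i < size rs)%N -> c \in cs ->
     nth (fun=> 0) rs i c = nth (fun=> 0) rs' i c) ->
  per rs cs = per rs' cs.
Proof.
elim: rs rs' cs => [|r rs IH] [|r' rs'] //= cs [sz] H.
rewrite !big_seq; apply: eq_bigr => c cin; congr (_ * _).
  by have := H 0%N c isT cin.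
by apply: IH => // i c' ilt c'in; apply: (H i.+1) => //; apply: mem_rem c'in.
Qed.

Lemma per_lin rs1 rs2 r0 r1 a cs :
  per (rs1 ++ (fun c => a * r0 c + r1 c) :: rs2) cs =
  a * per (rs1 ++ r0 :: rs2) cs + per (rs1 ++ r1 :: rs2) cs.
Proof.
elim: rs1 cs => [|r rs1 IH] cs /=; rewrite big_distrr -big_split /=;
  apply: eq_bigr => c _; last by rewrite IH; ring.
by ring.
Qed.

Lemma per_zero rs1 rs2 cs : per (rs1 ++ (fun=> 0) :: rs2) cs = 0.
Proof.
elim: rs1 cs => [|r rs1 IH] cs /=; apply: big1 => c _; first by rewrite mul0r.
by rewrite IH mulr0.
Qed.

Lemma per_block rs1 rs2 cs1 cs2 :
  size rs1 = size cs1 ->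
  (forall i c, (i < size rs1)%N -> c \in cs2 -> nth (fun=> 0) rs1 i c = 0) ->
  per (rs1 ++ rs2) (cs1 ++ cs2) = per rs1 cs1 * per rs2 cs2.
Proof.
elim: rs1 cs1 => [|r rs1 IH] cs1 /=.
  by move/esym/size0nil ->; rewrite mul1r.
move=> sz H; rewrite big_cat /= [X in _ + X]big_seq [X in _ + X]big1 ?addr0; last first.
  by move=> c cin; have /= -> := H 0%N c isT cin; rewrite mul0r.
rewrite mulr_suml !big_seq; apply: eq_bigr => c cin.
rewrite -mulrA -IH ?size_rem ?cin -?sz //; last by move=> i c' ilt; apply: (H i.+1).
congr (_ * _); apply: per_perm.
rewrite -(perm_cons c) -cat_cons.
rewrite perm_sym.
apply: (@perm_trans _ (cs1 ++ cs2)); first by rewrite perm_cat2r perm_sym perm_to_rem.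
by apply: perm_to_rem; rewrite mem_cat cin.
Qed.

End Permanent.

Lemma perm_map_rem (T U : eqType) (h : T -> U) c (cs : seq T) : c \in cs ->
  perm_eq (map h (rem c cs)) (rem (h c) (map h cs)).
Proof.
move=> cin; rewrite -(perm_cons (h c)).
apply: (@perm_trans _ (map h cs)); last by apply: perm_to_rem; apply: map_f.
by rewrite -map_cons; apply: perm_map; rewrite perm_sym; apply: perm_to_rem.
Qed.

Lemma per_map (T U : eqType) (h : T -> U) (rs : seq (U -> int)) (cs : seq T) :
  per [seq (fun c => r (h c)) | r <- rs] cs = per rs (map h cs).
Proof.
elim: rs cs => //= r rs IH cs; rewrite big_map !big_seq; apply: eq_bigr => c cin.
by rewrite IH; congr (_ * _); apply: per_perm; apply: perm_map_rem.
Qed.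

(** * Mixed derivatives of products of linear forms *)

Section Derivatives.
Variables (N : nat) (T : eqType) (L : T -> {mpoly int[N]}) (k : 'I_N -> T -> int).
Variable I : pred 'I_N.
Hypothesis dL : forall i c, I i -> (L c)^`M(i) = (k i c)%:MP.

Fixpoint mderivs (s : seq 'I_N) (p : {mpoly int[N]}) :=
  if s is i :: s' then mderivs s' p^`M(i) else p.

Lemma mderivs_sum (U : Type) (r : seq U) (F : U -> {mpoly int[N]}) (a : U -> int) s :
  mderivs s (\sum_(c <- r) a c *: F c) = \sum_(c <- r) a c *: mderivs s (F c).
Proof.
elim: s F => //= i s IH F; rewrite raddf_sum /= -IH.
by congr mderivs; apply: eq_bigr => c _; rewrite mderivZ.
Qed.

Lemma mderiv_prod_linear i (cs : seq T) : I i ->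
  (\prod_(c <- cs) L c)^`M(i) = \sum_(c <- cs) k i c *: \prod_(c' <- rem c cs) L c'.
Proof.
move=> Ii; elim: cs => [|c cs IH].
  by rewrite !big_nil -mpolyC1 mderivC.
rewrite !big_cons mderivM dL // IH /= eqxx mul_mpolyC; congr (_ + _).
rewrite mulr_sumr !big_seq; apply: eq_bigr => c' c'in.
rewrite -scalerAr; congr (_ *: _).
have [->|ne] := eqVneq c c'; last by rewrite big_cons.
by rewrite [RHS](perm_big _ (perm_to_rem c'in)) big_cons.
Qed.

(** By the product rule, the mixed derivative sums over all ways to assign the derivations to
    distinct factors, as the permanent does. *)
Lemma mderivs_prod_linear s (cs : seq T) : all I s -> size s = size cs ->
  (mderivs s (\prod_(c <- cs) L c))@_0 = per [seq k i | i <- s] cs.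
Proof.
elim: s cs => [|i s IH] cs /=.
  by move=> _ /esym/size0nil ->; rewrite big_nil mcoeff1 eqxx.
move=> /andP[Ii Is] sz; rewrite mderiv_prod_linear // mderivs_sum raddf_sum /= !big_seq.
apply: eq_bigr => c cin; rewrite mcoeffZ IH //.
by rewrite size_rem // -sz.
Qed.

Lemma mderivs_coeff s p m : (mderivs s p)@_m != 0 ->
  p@_(m + \sum_(i <- s) U_(i))%MM != 0.
Proof.
elim: s p => [|i s IH] p /=; first by rewrite big_nil addm0.
move/IH; rewrite mcoeff_mderiv big_cons => H.
apply: contraNneq H => H; rewrite -[X in X *+ _](_ : 0 = _) ?mul0rn //.
by rewrite -H; congr (_ @_ _); rewrite -addmA [(U_(i) + _)%MM]addmC.
Qed.
End Derivatives.

Fixpoint Alls (T : Type) (P : T -> Prop) (s : seq T) : Prop :=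
  if s is x :: s' then P x /\ Alls P s' else True.

Lemma Alls_cat (T : Type) (P : T -> Prop) s t :
  Alls P s -> Alls P t -> Alls P (s ++ t).
Proof. by elim: s => //= x s IH [Px Ps] Pt; split=> //; apply: IH. Qed.

Lemma Alls_map (T U : Type) (f : T -> U) (P : U -> Prop) s :
  Alls (fun x => P (f x)) s -> Alls P (map f s).
Proof. by elim: s => //= x s IH [? ?]; split=> //; apply: IH. Qed.

Lemma Alls_impl (T : Type) (P Q : T -> Prop) s :
  (forall x, P x -> Q x) -> Alls P s -> Alls Q s.
Proof. by move=> PQ; elim: s => //= x s IH [/PQ ? ?]; split=> //; apply: IH. Qed.

Lemma Alls_in (T : eqType) (P : T -> Prop) s :
  (forall x, x \in s -> P x) -> Alls P s.
Proof.
elim: s => //= x s IH H; split; first by apply: H; rewrite mem_head.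
by apply: IH => y ys; apply: H; rewrite in_cons ys orbT.
Qed.

Lemma set2_inj n (a b a' b' : 'I_n) : [set a; b] = [set a'; b'] ->
  (a < b)%N -> (a' < b')%N -> (a, b) = (a', b').
Proof.
move=> /setP s ab ab'; move: (s a) (s b) ab.
rewrite !inE !eqxx orbT /= => /esym/orP[]/eqP -> /esym/orP[]/eqP -> //;
  by move=> *; lia.
Qed.

(** * Certificates and choosability *)

Section Certificates.
Variable n : nat.
Local Notation vec := ('I_n -> int).
Local Notation edge := {set 'I_n}.
Implicit Types (E : {set edge}) (S : seq edge) (v : vec).

Definition row v (c : 'I_n * 'I_n) : int := v c.1 - v c.2.
Definition edge_vec (e : edge) : vec := fun i => (i \in e)%:R.

Fixpoint in_span S v : Prop :=
  if S is e :: S' then exists a : int, in_span S' (fun i => v i - a * edge_vec e i)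
  else forall i, v i = 0.

Definition ends (c : 'I_n * 'I_n) : edge := [set c.1; c.2].

Definition cert E (b : nat) : Prop :=
  exists (fs : seq (vec * seq edge)) (cs : seq ('I_n * 'I_n)),
  [/\ perm_eq (map ends cs) (enum E),
      size fs = size cs,
      Alls (fun f => in_span f.2 f.1 /\ {subset f.2 <= E}) fs,
      forall e, (count_mem e (flatten (map snd fs)) <= b)%N
    & per [seq row f.1 | f <- fs] cs != 0].

(** The permanent is linear in each row, so it is a combination of the permanents with an edge
    vector in this row, and these cannot all vanish. *)
Lemma per_span_choice rs1 rs2 S v cs : in_span S v ->
  per (rs1 ++ row v :: rs2) cs != 0 ->
  exists2 e, e \in S & per (rs1 ++ row (edge_vec e) :: rs2) cs != 0.
Proof.
have per_eq u u' rs1' rs2' : (forall c, u c = u' c) ->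
    per (rs1' ++ u :: rs2') cs = per (rs1' ++ u' :: rs2') cs.
  move=> uu; apply: eq_per => [|i c _ _]; first by rewrite !size_cat.
  by rewrite !nth_cat; case: ifP => // _; case: (i - _)%N => /=.
elim: S v => [|e S IH] v /=.
  move=> v0; rewrite (per_eq _ (fun=> 0)) ?per_zero ?eqxx // => c.
  by rewrite /row !v0 subrr.
move=> [a sp].
rewrite (per_eq _ (fun c => a * row (edge_vec e) c +
                   row (fun i => v i - a * edge_vec e i) c)); last first.
  by move=> c; rewrite /row; ring.
rewrite per_lin => H.
have [e0|ne] := eqVneq (per (rs1 ++ row (edge_vec e) :: rs2) cs) 0; last first.
  by exists e; rewrite ?mem_head.
move: H; rewrite e0 mulr0 add0r => /(IH _ sp) [e' e'S ne'].
by exists e' => //; rewrite in_cons e'S orbT.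
Qed.

Lemma per_edges_choice (fs : seq (vec * seq edge)) rs cs :
  Alls (fun f => in_span f.2 f.1) fs ->
  per (rs ++ [seq row f.1 | f <- fs]) cs != 0 ->
  exists es : seq edge, [/\ size es = size fs,
    {subset es <= flatten (map snd fs)},
    forall e, (count_mem e es <= count_mem e (flatten (map snd fs)))%N
    & per (rs ++ [seq row (edge_vec e) | e <- es]) cs != 0].
Proof.
elim: fs rs => [|f fs IH] rs /=; first by move=> _ H; exists [::].
move=> [spf spfs] /(per_span_choice spf) [e eS].
rewrite -cat_rcons => /(IH _ spfs) [es [sz in_subtree cnt ne]].
exists (e :: es); split=> /=; rewrite ?sz //; last by rewrite -cat_rcons.
  move=> x; rewrite in_cons mem_cat => /orP[/eqP-> |/in_subtree ->]; by rewrite ?eS ?orbT.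
move=> e'; rewrite count_cat leq_add //.
by have [<-|_ //] := eqVneq e e'; rewrite /= -has_count has_pred1.
Qed.

Definition orient (c : 'I_n * 'I_n) := if (c.1 < c.2)%N then c else (c.2, c.1).

(** Reversing an edge only changes the sign of the product, so the columns may be oriented as the
    block and triangular shapes require. *)
Lemma PG_cols E cs : is_graph E -> perm_eq (map ends cs) (enum E) ->
  exists a : int, (a != 0) /\
  PG E = a *: \prod_(c <- cs) (sum_at E c.1 - sum_at E c.2).
Proof.
move=> gE pE.
have csE c : c \in cs -> ends c \in E.
  by move=> cin; rewrite -mem_enum -(perm_mem pE) map_f.
have neq c : c \in cs -> c.1 != c.2.
  move=> /csE/gE; rewrite /ends cards2; by case: eqP.
have orE c : ends (orient c) = ends c.
  by rewrite /orient /ends; case: ifP => // _; rewrite setUC.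
pose L c := sum_at E c.1 - sum_at E c.2.
have -> : PG E = \prod_(c <- map orient cs) L c.
  rewrite /PG pair_big_dep /= -big_filter.
  apply: perm_big; apply: uniq_perm; first by rewrite filter_uniq // index_enum_uniq.
    rewrite -(map_inj_in_uniq (f := ends)) -?map_comp; last first.
      move=> _ _ /mapP[c cin ->] /mapP[c' cin' ->]; rewrite /orient /ends.
      move: (neq _ cin) (neq _ cin'); case: c {cin} => x y; case: c' {cin'} => x' y' /=.
      rewrite -!val_eqE /= => n1 n2.
      by case: ifP => h; case: ifP => h' /= /set2_inj; apply=> //;
        rewrite ltn_neqAle eq_sym leqNgt ?h ?h' ?n1 ?n2.
    have -> : [seq (ends \o orient) i | i <- cs] = map ends cs.
      by apply: eq_map => c; apply: orE.
    by rewrite (perm_uniq pE) enum_uniq.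
  move=> [x y]; rewrite mem_filter mem_index_enum andbT /=.
  apply/andP/mapP => [[xy xyE]|[c cin e]].
    have : [set x; y] \in map ends cs by rewrite (perm_mem pE) mem_enum.
    case/mapP => c cin e; exists c => //; rewrite /orient.
    have := neq _ cin; rewrite -val_eqE /= => nc.
    case: ifP => h; first by rewrite [c]surjective_pairing; apply: set2_inj.
    apply: set2_inj => //; first by rewrite e /ends setUC.
    by rewrite ltn_neqAle eq_sym nc leqNgt h.
  have := csE _ cin; rewrite -orE -e => ?; split=> //.
  move: e (neq _ cin); rewrite /orient -val_eqE /=.
  by case: ifP => h; [case: c h {cin} => ? ? h [-> ->]|move=> [-> ->]; lia].
elim: cs {pE csE neq} => [|c cs [a [a0 IH]]].
  by exists 1; rewrite !big_nil scale1r.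
rewrite /= !big_cons {}IH /orient; case: ifP => _.
  by exists a; rewrite scalerAr.
exists (- a); rewrite oppr_eq0 a0; split=> //.
by rewrite /L /= -opprB mulNr -scalerAr scaleNr.
Qed.

(** After every vector is replaced by one of its listed edge vectors, the permanent is the mixed
    derivative of [PG E], up to sign, along the variables of the chosen edges. So the monomial in
    which each edge has its multiplicity among them occurs. *)
Lemma cert_choosable E b : is_graph E -> cert E b -> alg_choosable E b.+1.
Proof.
move=> gE [fs [cs [pE sz sp cnt ne]]].
have [||es [szes in_subtree cntes ne']] := @per_edges_choice fs [::] cs.
- by apply: Alls_impl sp => f [].
- by [].
have esE e : e \in es -> e \in E.
  move/in_subtree => {}in_subtree; elim: fs sp in_subtree {sz cnt ne szes cntes} => //= f fs IH [[_ fE] sp].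
  by rewrite mem_cat => /orP[/fE //|]; apply: IH.
have [a [a0 PGE]] := PG_cols gE pE.
pose s := map enum_rank es.
have mE e : (\sum_(i <- s) U_(i))%MM (enum_rank e) = count_mem e es.
  rewrite mnm_sumE big_map -sum1_count [RHS]big_mkcond /=; apply: eq_bigr => e' _.
  by rewrite mnm1E (inj_eq enum_rank_inj) /=; case: eqP.
exists (\sum_(i <- s) U_(i))%MM; split.
- rewrite mcoeff_msupp PGE mcoeffZ mulf_neq0 // -[X in _@_X]add0m.
  apply: mderivs_coeff.
  rewrite (@mderivs_prod_linear _ _ _ (fun i => row (edge_vec (enum_val i)))
     (fun i => enum_val i \in E)).
  + by rewrite -map_comp (eq_map (g := fun e => row (edge_vec e))) // => e /=; rewrite enum_rankK.
  + move=> i [x y] iE; rewrite /row /edge_vec /= mderivB mpolyCB.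
    have H z : (sum_at E z)^`M(i) = ((z \in enum_val i)%:R)%:MP.
      rewrite /sum_at raddf_sum /= (bigID (pred1 (enum_val i))) /= [X in _ + X]big1 ?addr0.
        rewrite (eq_bigr (fun=> 1)).
          rewrite big_const (_ : #|_| = (z \in enum_val i)).
            by case: (_ \in _) => /=; rewrite ?addr0 ?mpolyC1 ?mpolyC0.
          have [zin|zn] := boolP (z \in enum_val i).
            rewrite (eq_card (B := pred1 (enum_val i))) ?card1 // => e; rewrite unfold_in /= !inE.
            by case: eqP => [->|]; rewrite ?andbF // iE zin.
          apply: eq_card0 => e; rewrite unfold_in /= !inE; apply/negbTE.
          by case: eqP => [->|]; rewrite ?andbF // iE (negbTE zn).
        move=> e /andP[_ /eqP ->]; rewrite /xe enum_valK mderivX mnm1E eqxx scale1r.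
        by rewrite (_ : (_ - _)%MM = 0%MM) ?mpolyX0 //; apply/mnmP => j; rewrite mnmBE mnm0E subnn.
      move=> e /andP[_ ne0]; rewrite /xe mderivX mnm1E.
      rewrite (_ : (_ == i) = false) ?scale0r //.
      by apply: contraNF ne0 => /eqP <-; rewrite enum_rankK.
    by rewrite !H.
  + by apply/allP => i /mapP[e ein ->]; rewrite enum_rankK esE.
  + by rewrite size_map szes.
- move=> e; rewrite mE => eE; apply/eqP; rewrite -leqn0 leqNgt -has_count has_pred1.
  by apply: contra eE => /esE.
- by move=> e _; rewrite mE (leq_trans (cntes e)).
- rewrite mdeg_sum (eq_bigr (fun=> 1%N)); last by move=> i _; rewrite mdeg1.
  rewrite big_map sum1_size szes sz.
  by rewrite -(size_map ends) (perm_size pE) cardE.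
Qed.

End Certificates.

(** * Products of squares of binomial forms *)

Section Reciprocal.
Variable n : nat.
Implicit Types (F : {mpoly int[n]}) (m N : 'X_{1..n}) (b : 'I_n).

Lemma mcoeffMXi F b m :
  (F * 'X_b)@_m = if (0 < m b)%N then F@_(m - U_(b)) else 0.
Proof.
have [mb|mb] := boolP (0 < m b)%N.
  have {1}-> : (m = U_(b) + (m - U_(b)))%MM; last by rewrite mcoeffMX.
  apply/mnmP => i; rewrite mnmDE mnmBE mnm1E.
  by have [<-|_] := eqVneq b i => /=; lia.
apply/eqP; rewrite mcoeff_eq0; apply: contra mb.
rewrite (perm_mem (msuppMX _ _)) => /mapP[k _ ->].
by rewrite mnmDE mnm1E eqxx.
Qed.

(** The coefficients are invariant under the reflection of exponents at [N], up to the factor [eps].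
    Writing [m + m' = N] avoids truncated subtraction; the second clause keeps the support in the
    range where the reflection is defined. *)
Definition recip F N (eps : int) : Prop :=
  (forall m m', (m + m' = N)%MM -> F@_m = eps * F@_m') /\
  (forall m, F@_m != 0 -> forall i, (m i <= N i)%N).

Definition sgz2 (s : bool) : int := if s then -1 else 1.

Definition binomial_form (s : bool) b (s' : bool) b' : {mpoly int[n]} :=
  sgz2 s *: 'X_b - sgz2 s' *: 'X_b'.

Lemma recip1 : recip 1 0%MM 1.
Proof.
split=> [m m' mm|m]; rewrite !mcoeff1.
  have e0 : (m = 0)%MM /\ (m' = 0)%MM.
    split; apply/mnmP => i; have := congr1 (fun k : 'X_{1..n} => k i) mm;
    by rewrite mnmDE mnm0E => /eqP; rewrite addn_eq0 => /andP[/eqP ? /eqP ?].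
  by rewrite e0.1 e0.2 mul1r.
by have [-> _ i|_ /eqP //] := eqVneq m 0%MM.
Qed.

Lemma recip_mul F N eps s b s' b' : recip F N eps ->
  exists eps', recip (F * binomial_form s b s' b') (N + (U_(b) + U_(b')))%MM eps'.
Proof.
(* Reflection exchanges the two variables of the binomial, which multiplies it by minus the product
   of its signs. *)
move=> [rF sF]; exists (- (eps * sgz2 s * sgz2 s')).
have coefE m : (F * binomial_form s b s' b')@_m =
    sgz2 s * (if (0 < m b)%N then F@_(m - U_(b)) else 0)
    - sgz2 s' * (if (0 < m b')%N then F@_(m - U_(b')) else 0).
  by rewrite mulrBr -!scalerAr mcoeffB !mcoeffZ !mcoeffMXi.
(* Removing one variable on one side corresponds to removing the other variable on the reflected
   side; if only one removal is possible, the bound on the support makes that term zero. *)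
have half c c' m m' : (m + m' = N + (U_(c) + U_(c')))%MM ->
    (if (0 < m c)%N then F@_(m - U_(c)) else 0) =
    eps * (if (0 < m' c')%N then F@_(m' - U_(c')) else 0).
  move=> mm; have mmi i : (m i + m' i = N i + ((c == i) + (c' == i)))%N.
    by have := congr1 (fun k : 'X_{1..n} => k i) mm; rewrite !mnmDE !mnm1E.
  case: ifP => mc; case: ifP => mc'.
  - apply: rF; apply/mnmP => i; have := mmi i; rewrite mnmDE !mnmBE !mnm1E.
    by have [e|_] := eqVneq c i; have [e'|_] := eqVneq c' i; subst => /=; lia.
  - rewrite mulr0; apply/eqP; apply: contraFT mc' => /sF /(_ c').
    rewrite mnmBE mnm1E; have := mmi c'; rewrite eqxx /=; lia.
  - apply/esym/eqP; rewrite mulf_eq0; apply/orP; right.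
    apply: contraFT mc => /sF /(_ c).
    rewrite mnmBE mnm1E; have := mmi c; rewrite eqxx /= [c' == c]eq_sym; lia.
  - by rewrite mulr0.
split=> [m m' mm|m].
  rewrite !coefE (half b b' m m') // (half b' b m m'); last by rewrite mm [(U_(b) + _)%MM]addmC.
  by move: (if _ then _ else _) (if _ then _ else _) => x y;
    rewrite /sgz2; case: (s); case: (s') => /=; ring.
rewrite coefE => nz i; rewrite !mnmDE !mnm1E.
have [z|nz1] := eqVneq (if (0 < m b)%N then F@_(m - U_(b)) else 0) 0.
  move: nz; rewrite z mulr0 add0r oppr_eq0 mulf_eq0 negb_or => /andP[_].
  case: ifP => [mb /sF /(_ i)|]; last by rewrite eqxx.
  rewrite mnmBE mnm1E; lia.
move: nz1; case: ifP => [mb /sF /(_ i)|]; last by rewrite eqxx.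
rewrite mnmBE mnm1E; lia.
Qed.

Lemma recip_sqr_neq0 F N eps : recip F N eps -> F != 0 -> (F * F)@_N != 0.
Proof.
move=> [rF sF] F0.
rewrite mcoeffM.
under eq_bigr => k /eqP Nk do rewrite (rF k.1 k.2 (esym Nk)) -mulrA -expr2.
rewrite -mulr_sumr mulf_eq0 negb_or.
have [m mF] : exists m, F@_m != 0.
  move: F0; rewrite -msupp_eq0; case E: (msupp F) => [|m s] // _.
  by exists m; rewrite -mcoeff_msupp E mem_head.
have mN i : (m i <= N i)%N by apply: sF.
have Nm : N = ((N - m) + m)%MM by rewrite submK //; apply/mnm_lepP.
apply/andP; split.
  by apply: contraNneq mF => e; rewrite (rF m (N - m)%MM) ?e ?mul0r // addmC -Nm.
have b1 : (mdeg (N - m)%MM < (mdeg N).+1)%N.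
  by rewrite ltnS [X in (_ <= mdeg X)%N]Nm mdegD leq_addr.
have b2 : (mdeg m < (mdeg N).+1)%N by rewrite ltnS Nm mdegD leq_addl.
apply: contraNneq mF => /eqP; rewrite psumr_eq0 => [|k _]; last exact: sqr_ge0.
move=> /allP /(_ (BMultinom b1, BMultinom b2)); rewrite mem_index_enum /= => /(_ isT).
by rewrite -Nm eqxx /= sqrf_eq0 => /eqP ->.
Qed.

Definition bform := (bool * 'I_n * (bool * 'I_n))%type.
Definition bform_poly (f : bform) := binomial_form f.1.1 f.1.2 f.2.1 f.2.2.
Definition bform_mnm (f : bform) : 'X_{1..n} := (U_(f.1.2) + U_(f.2.2))%MM.

Lemma bform_poly_neq0 (f : bform) : f.1 != f.2 -> bform_poly f != 0.
Proof.
case: f => [[s b] [s' b']] ne; apply/eqP => e0.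
have := congr1 (mcoeff U_(b)) e0; rewrite /bform_poly /binomial_form /=.
rewrite mcoeffB !mcoeffZ !mcoeffXU mcoeff0 eqxx mulr1.
(* For equal variables the signs differ and the coefficient is 2 or -2, otherwise it is 1 or -1. *)
move: ne; rewrite /= xpair_eqE /sgz2; have [_|_] := eqVneq b b';
  by case: s {e0}; case: s'.
Qed.

Lemma recip_prod (fs : seq bform) :
  exists eps, recip (\prod_(f <- fs) bform_poly f) (\sum_(f <- fs) bform_mnm f)%MM eps.
Proof.
elim: fs => [|f fs [eps IH]]; first by exists 1; rewrite !big_nil; apply: recip1.
have [eps' H] := recip_mul f.1.1 f.1.2 f.2.1 f.2.2 IH.
by exists eps'; rewrite !big_cons mulrC addmC.
Qed.

Lemma prod_bform_neq0 (fs : seq bform) : all (fun f => f.1 != f.2) fs ->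
  \prod_(f <- fs) bform_poly f != 0.
Proof.
elim: fs => [|f fs IH] /=; first by rewrite big_nil oner_eq0.
by case/andP=> nf /IH nfs; rewrite big_cons mulf_neq0 ?bform_poly_neq0.
Qed.

(* In a product of squares of the forms [f], the coefficient of the product of
   the two variables of every [f] is, up to sign, a sum of squares, because each
   form is reciprocal. One extra linear factor is tolerated: squaring it as well
   gives two terms that are exchanged by the reciprocity. *)
Lemma prod_sqr_coeff_neq0 (fs ls : seq bform) :
  all (fun f => f.1 != f.2) (ls ++ fs) -> (size ls <= 1)%N ->
  (\prod_(f <- ls ++ fs ++ fs) bform_poly f)@_
    (\sum_(l <- ls) U_(l.1.2) + \sum_(f <- fs) bform_mnm f)%MM != 0.
Proof.
case: ls => [|l [|//]] nz _ /=.
  rewrite big_nil add0m big_cat /=.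
  by have [eps /recip_sqr_neq0] := recip_prod fs; apply; apply: prod_bform_neq0.
rewrite big_seq1.
set P := \prod_(_ <- _) _; set N := (\sum_(_ <- _) _)%MM.
have [eps /recip_sqr_neq0/(_ (prod_bform_neq0 nz))] := recip_prod (l :: fs).
have [eps2 [/(_ (U_(l.2.2) + N) (U_(l.1.2) + N))%MM rP _]] := recip_prod (l :: fs ++ fs).
rewrite -/P big_cons big_cat /= -/N in rP.
have -> : \prod_(f <- l :: fs) bform_poly f * \prod_(f <- l :: fs) bform_poly f =
          P * bform_poly l.
  by rewrite /P !big_cons big_cat /=; ring.
rewrite big_cons -/N.
rewrite /bform_poly mulrBr -!scalerAr mcoeffB !mcoeffZ /bform_mnm -addmA mcoeffMX.
rewrite addmA [(U_(l.1.2) + _)%MM]addmC -addmA mcoeffMX rP; last first.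
  by apply/mnmP => i; rewrite /bform_mnm !mnmDE; lia.
by apply: contraNneq => ->; rewrite !mulr0 subrr.
Qed.

End Reciprocal.

(** * Permanents as coefficients *)

Section PermanentCoefficient.
Variable n : nat.
Implicit Types (vs : seq ('I_n -> int)) (bs : seq 'I_n).

Definition linpoly (v : 'I_n -> int) : {mpoly int[n]} := \sum_i v i *: 'X_i.

Lemma big_seq_count (f : 'I_n -> int) bs :
  \sum_(c <- bs) f c = \sum_i (count_mem i bs)%:R * f i.
Proof.
elim: bs => [|c bs IH]; first by rewrite big_nil big1 // => i _; rewrite mul0r.
rewrite big_cons IH [RHS](eq_bigr (fun i => (i == c)%:R * f i + (count_mem i bs)%:R * f i)).
  rewrite big_split /=; congr (_ + _); rewrite (bigD1 c) //= eqxx mul1r big1 ?addr0 //.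
  by move=> i /negbTE ->; rewrite mul0r.
by move=> i _; rewrite /= natrD mulrDl [c == i]eq_sym.
Qed.

(** Equal columns are told apart by the permanent but not by the coefficient, hence the
    factorials. *)
Lemma per_mcoeff vs bs : size vs = size bs ->
  per vs bs = (\prod_(v <- vs) linpoly v)@_(\sum_(b <- bs) U_(b))%MM *
              (\prod_i (count_mem i bs)`!)%:R.
Proof.
elim: vs bs => [|v vs IH] bs /=.
  move/esym/size0nil ->; rewrite !big_nil mcoeff1 eqxx mul1r big1 //.
move=> sz; rewrite big_seq (eq_bigr (fun c => v c * ((\prod_(v <- vs) linpoly v)@_
    (\sum_(b <- rem c bs) U_(b)) * (\prod_i (count_mem i (rem c bs))`!)%:R))); last first.
  by move=> c cin; rewrite IH // size_rem // -sz.
rewrite -big_seq big_seq_count big_cons [linpoly v * _]mulrC.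
have -> : linpoly v = \sum_i v i *: 'X_i by [].
rewrite mulr_sumr raddf_sum /= mulr_suml.
apply: eq_bigr => i _; rewrite -scalerAr mcoeffZ.
have N_i : (\sum_(b <- bs) U_(b))%MM i = count_mem i bs.
  rewrite mnm_sumE -sum1_count [RHS]big_mkcond /=; apply: eq_bigr => e' _.
  by rewrite mnm1E; case: eqP.
have [iin|inot] := boolP (i \in bs); last first.
  rewrite (count_memPn inot) mul0r mcoeffMXi N_i (count_memPn inot) ltnn.
  by rewrite mulr0 mul0r.
have -> : (\prod_j (count_mem j bs)`! = count_mem i bs * \prod_j (count_mem j (rem i bs))`!)%N.
  rewrite (bigD1 i) //= [in RHS](bigD1 i) //= mulnA; congr (_ * _)%N.
    by rewrite (permP (perm_to_rem iin)) /= eqxx add1n factS.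
  apply: eq_bigr => j ji; rewrite (permP (perm_to_rem iin)) /=.
  by rewrite eq_sym (negbTE ji).
rewrite (perm_big _ (perm_to_rem iin)) big_cons mcoeffMX natrM; ring.
Qed.
End PermanentCoefficient.

(** * Certificates of graphs *)

Lemma Alls_nth (T : Type) (P : T -> Prop) x0 s i : Alls P s -> (i < size s)%N -> P (nth x0 s i).
Proof. by elim: s i => //= x s IH [|i] [Px Ps] // lt; apply: IH. Qed.

(** * Spans of edge vectors and disjoint unions *)

Section Spans.
Variable n : nat.
Local Notation vec := ('I_n -> int).
Local Notation edge := {set 'I_n}.
Implicit Types (S : seq edge) (v : vec).

Lemma eq_in_span S v v' : v =1 v' -> in_span S v -> in_span S v'.
Proof.
elim: S v v' => [|e S IH] v v' /= vv; first by move=> H i; rewrite -vv.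
by move=> [a H]; exists a; apply: IH H => i; rewrite vv.
Qed.

Lemma in_spanZ S v (a : int) : in_span S v -> in_span S (fun i => a * v i).
Proof.
elim: S v => [|e S IH] v /=; first by move=> H i; rewrite H mulr0.
by move=> [b /IH H]; exists (a * b); apply: eq_in_span H => i /=; ring.
Qed.

Lemma in_span_lin S S' v v' (a : int) : in_span S v -> in_span S' v' ->
  in_span (S ++ S') (fun i => v i + a * v' i).
Proof.
move=> + sv'; elim: S v => [|e S IH] v /=.
  by move=> v0; apply: eq_in_span (in_spanZ a sv') => i; rewrite v0 add0r.
by move=> [b /IH H]; exists b; apply: eq_in_span H => i /=; ring.
Qed.

Lemma in_span_edge (x y : 'I_n) : x != y -> in_span [:: [set x; y]] (fun i => (i == x)%:R + (i == y)%:R).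
Proof.
move=> xy /=; exists 1 => i; rewrite /edge_vec mul1r !inE.
have [->|_] := eqVneq i x; first by rewrite (negbTE xy) addr0 subrr.
by rewrite add0r subrr.
Qed.

Lemma in_span_out S v i : in_span S v -> (forall e, e \in S -> i \notin e) -> v i = 0.
Proof.
elim: S v => [|e S IH] v /=; first by move=> H _.
move=> [a /IH H] out.
have := H (fun e' e'S => out e' (mem_behead (s := e :: S) e'S)); rewrite /edge_vec.
by rewrite (negbTE (out e (mem_head _ _))) mulr0 subr0.
Qed.

(** When a relay is passed from [c] to [w], the form of the relay at [c] is subtracted from
    [y_c + y_w]; this cancels [y_c] and reverses the sign of the origin. *)
Lemma unit_span (adj : rel 'I_n) (B : pred 'I_n) w u : irreflexive adj -> relay_at adj B w u ->
  in_span u.2 (fun i => sgz2 u.1.1 * (i == u.1.2)%:R + (i == w)%:R).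
Proof.
move=> irr; elim=> {w u} [w b wb Bb|c w s b S iu IH cw] /=.
  have wb' : w != b by apply: contraTneq wb => ->; rewrite irr.
  by apply: eq_in_span (in_span_edge wb') => i /=; ring.
have cw' : c != w by apply: contraTneq cw => ->; rewrite irr.
have := in_span_lin (-1) (in_span_edge cw') IH => /= -[a H]; exists a.
by apply: eq_in_span H => i /=; case: s {IH iu}; rewrite /sgz2 /=; ring.
Qed.

Lemma unit_subset (adj : rel 'I_n) (B : pred 'I_n) (E : {set edge}) w u :
  (forall x y, adj x y -> [set x; y] \in E) -> relay_at adj B w u -> {subset u.2 <= E}.
Proof.
move=> aE; elim=> {w u} [w b wb _|c w s b S _ IH cw] e /=; rewrite inE.
  by move/eqP ->; apply: aE.
by case/orP => [/eqP ->|/IH //]; apply: aE.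
Qed.

(** A vector in the span of edges of [E1] vanishes at the ends of the edges of [E2], so the joint
    permanent is block triangular. *)
Lemma cert_union (E1 E2 : {set edge}) b : is_graph E1 ->
  (forall e1 e2, e1 \in E1 -> e2 \in E2 -> [disjoint e1 & e2]) ->
  cert E1 b -> cert E2 b -> cert (E1 :|: E2) b.
Proof.
move=> g1 dis [fs1 [cs1 [p1 s1 a1 c1 n1]]] [fs2 [cs2 [p2 s2 a2 c2 n2]]].
have E12 e : e \in E1 -> e \notin E2.
  move=> e1; apply/negP => e2; have := dis _ _ e1 e2; rewrite -setI_eq0 setIid => /eqP e0.
  by have := g1 _ e1; rewrite e0 cards0.
exists (fs1 ++ fs2), (cs1 ++ cs2); split.
- rewrite map_cat (perm_trans (perm_cat p1 p2)) //; apply: uniq_perm; rewrite ?enum_uniq //.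
    rewrite cat_uniq !enum_uniq andbT /=; apply/hasPn => e; rewrite !mem_enum => e2.
    by apply/negP => /E12; rewrite e2.
  by move=> e; rewrite mem_cat !mem_enum inE.
- by rewrite !size_cat s1 s2.
- apply: Alls_cat; [apply: Alls_impl a1|apply: Alls_impl a2] => f [sp sb]; split=> // e /sb;
    by rewrite inE => ->; rewrite ?orbT.
- have cnt0 (fs : seq (vec * seq edge)) (E : {set edge}) e :
      Alls (fun f => in_span f.2 f.1 /\ {subset f.2 <= E}) fs -> e \notin E ->
      count_mem e (flatten (map snd fs)) = 0%N.
    move=> + eE; elim: fs => //= f fs IH [[_ sb] /IH h]; rewrite count_cat h addn0.
    by apply/count_memPn; apply: contra eE => /sb.
  move=> e; rewrite map_cat flatten_cat count_cat.
  have [e1|e1] := boolP (e \in E1); last by rewrite (cnt0 _ _ _ a1 e1) add0n.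
  by rewrite (cnt0 _ _ _ a2 (E12 _ e1)) addn0.
rewrite map_cat per_block ?size_map ?mulf_neq0 // => i c lt c2'.
pose f0 : vec * seq edge := ((fun=> 0), [::]).
have [sp sb] := Alls_nth f0 a1 lt.
rewrite (nth_map f0) //.
have eE : ends c \in E2 by rewrite -mem_enum -(perm_mem p2) map_f.
rewrite /row !(in_span_out sp) ?subrr // => e /sb e1; have := dis _ _ e1 eE;
  rewrite disjoint_sym => /disjointFr -> //; by rewrite !inE eqxx ?orbT.
Qed.
End Spans.

(** Expansion along the row of smallest depth. The lower end of every column is deeper than the
    label, so this row has entry 1 at the columns whose upper end is the label and 0 elsewhere.
    Several columns may share that end, which is why positivity rather than a product is carried
    through the induction. *)
Lemma per_triangular (V : eqType) (D : eqType) (lab : D -> V) (vec : D -> V -> int) (d : V -> nat)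
    (P : pred V) (rows : seq D) (cs : seq (V * V)) :
  sorted (fun x y => d (lab x) <= d (lab y))%N rows ->
  perm_eq (map lab rows) (map fst cs) ->
  {in rows, forall t, vec t (lab t) = 1 /\
     forall x, P x -> (d (lab t) <= d x)%N -> x != lab t -> vec t x = 0} ->
  {in cs, forall c, [/\ P c.1, P c.2 & (d c.1 < d c.2)%N]} ->
  0 < per [seq (fun c => vec t c.1 - vec t c.2) | t <- rows] cs.
Proof.
elim: rows cs => [|t rows IH] cs srt pe Hr Hc /=; first exact: ltr01.
have tmin c : c \in cs -> (d (lab t) <= d c.1)%N.
  move=> cin; have : c.1 \in map fst cs by apply: map_f.
  rewrite -(perm_mem pe) inE => /orP[/eqP -> //|/mapP[t' t'r ->]].
  move: srt => /= /(order_path_min (fun y x z => @leq_trans (d (lab y)) (d (lab x)) (d (lab z)))).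
  by move/allP => /(_ _ t'r).
have [v1 v0] := Hr t (mem_head _ _).
have val c : c \in cs -> vec t c.1 - vec t c.2 = (c.1 == lab t)%:R.
  move=> cin; have [P1 P2 lt] := Hc c cin; have := tmin c cin => le.
  have lt2 : (d (lab t) < d c.2)%N by apply: leq_ltn_trans le lt.
  rewrite (v0 c.2) ?subr0 ?(ltnW lt2) //; last by apply: contraTneq lt2 => ->; rewrite ltnn.
  by have [->|ne] := eqVneq c.1 (lab t); rewrite ?v1 ?v0.
have pos c : c \in cs -> c.1 = lab t ->
    0 < per [seq (fun c => vec t c.1 - vec t c.2) | t <- rows] (rem c cs).
  move=> cin ct; apply: IH.
  - by move: srt => /= /path_sorted.
  - rewrite -(perm_cons (lab t)) (perm_trans pe) // -ct -[c.1 :: _]/(map fst (c :: rem c cs)).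
    exact/perm_map/perm_to_rem.
  - by move=> t' t'r; apply: Hr; rewrite inE t'r orbT.
  by move=> c' /mem_rem; apply: Hc.
have /mapP[c0 c0in c0t] : lab t \in map fst cs by rewrite -(perm_mem pe) mem_head.
rewrite (perm_big _ (perm_to_rem c0in)) big_cons /= val // -c0t eqxx mul1r.
apply: ltr_wpDr; last exact: pos.
rewrite big_seq; apply: sumr_ge0 => c /mem_rem cin; rewrite val // c0t.
case: eqP => [ct|_]; last by rewrite mul0r.
by rewrite mul1r ltW // pos // c0t.
Qed.

Lemma set2_eq (T : finType) (a b a' b' : T) : [set a; b] = [set a'; b'] -> a != b ->
  (a, b) = (a', b') \/ (a, b) = (b', a').
Proof.
move=> /setP e; move: (e a) (e b); rewrite !inE !eqxx orbT /=.
by move=> /esym/orP[]/eqP-> /esym/orP[]/eqP->; rewrite ?eqxx //; [left|right].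
Qed.

(** * Assembling the certificate of a connected graph *)

Section Component.
Variables (n : nat) (E : {set {set 'I_n}}) (r : 'I_n).
Local Notation V := 'I_n.
Definition eadj : rel V := fun x y => [set x; y] \in E.
Hypothesis gE : is_graph E.
Local Notation C := (connect eadj r).
Hypothesis adjC : forall x y, eadj x y -> C x.

Lemma eadj_sym : ssrbool.symmetric eadj.
Proof. by move=> x y; rewrite /eadj setUC. Qed.

Lemma eadj_irr : irreflexive eadj.
Proof. by move=> x; apply/negP => /gE; rewrite setUid cards1. Qed.

Section Assembly.
Variables (p : V -> V) (d : V -> nat) (B : pred V).
Hypothesis nt : normal_tree eadj r p d.
Local Notation "x ~< y" := (anc p d x y) (at level 70).
Hypothesis Bspec : forall v, B v = ~~ [exists u, (eadj v u && (v ~< u)) && B u].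
Local Notation link := (link eadj r p d B).
Local Notation needy := (needy eadj p d B).
Local Notation upA := (upA eadj p d B).
Local Notation AB_cols := (AB_cols eadj B).
Variables (ls F : seq (relay V * relay V)) (ex : V -> relay V).
Hypotheses (ls1 : (size ls <= 1)%N) (okF : {in ls ++ F, forall f, form_ok eadj B f})
  (exU : forall y, needy y -> relay_at eadj B y (ex y))
  (chips : perm_eq ([seq f.1.1.2 | f <- ls ++ F] ++ [seq f.2.1.2 | f <- F]) (map fst AB_cols))
  (loads : forall e, (2 * count_mem e (flatten [seq f.1.2 ++ f.2.2 | f <- F]) +
         count_mem e (flatten [seq f.1.2 ++ f.2.2 | f <- ls]) +
         \sum_(y | needy y) count_mem e (ex y).2 <=
         4 * count_mem e [seq [set c.2; c.1] | c <- AB_cols] +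
         3 * \sum_(y | needy y) ([set y; link y] == e))%N).

Definition B_form (f : relay V * relay V) (i : V) : int :=
  sgz2 f.1.1.1 * (i == f.1.1.2)%:R - sgz2 f.2.1.1 * (i == f.2.1.2)%:R.

Lemma bvec_span f : form_ok eadj B f ->
  in_span (f.1.2 ++ f.2.2) (B_form f) /\ {subset f.1.2 ++ f.2.2 <= E}.
Proof.
case=> w [i1 i2 _]; split.
  have := in_span_lin (-1) (unit_span eadj_irr i1) (unit_span eadj_irr i2).
  by apply: eq_in_span => i; rewrite /B_form; ring.
by move=> e; rewrite mem_cat => /orP[]; apply: (unit_subset (fun x y h => h)); eassumption.
Qed.

Lemma bvec_out f i : form_ok eadj B f -> ~~ B i -> B_form f i = 0.
Proof.
case=> w [/(relay_origin eadj_sym adjC)[B1 _] /(relay_origin eadj_sym adjC)[B2 _] _] Bi.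
rewrite /B_form; have /negbTE-> : i != f.1.1.2 by apply: contraNneq Bi => ->.
have /negbTE-> : i != f.2.1.2 by apply: contraNneq Bi => ->.
by rewrite !mulr0 subrr.
Qed.

Lemma linpoly_bvec f : linpoly (B_form f) = bform_poly (f.1.1, f.2.1).
Proof.
have del b : 'X_b = \sum_i (i == b)%:R *: 'X_i :> {mpoly int[n]}.
  rewrite (bigD1 b) //= eqxx scale1r big1 ?addr0 // => i /negbTE ->; by rewrite scale0r.
rewrite /linpoly /bform_poly /binomial_form /= [in RHS]del [X in _ = _ - _ *: X]del.
rewrite !scaler_sumr -sumrB; apply: eq_bigr => i _; rewrite /B_form scalerBl.
by rewrite !scalerA.
Qed.

Lemma ABcP b w : ((b, w) \in AB_cols) = [&& ~~ B w, B b & eadj w b].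
Proof.
apply/allpairsPdep/and3P => [[w' [b' [+ + [-> ->]]]]|[Bw Bb wb]].
  by rewrite !mem_enum !inE => ? /andP[].
by exists w, b; rewrite !mem_enum !inE Bw wb Bb.
Qed.

Lemma size_forms : size (ls ++ F ++ F) = size AB_cols.
Proof.
have := perm_size chips; rewrite !size_cat !size_map size_cat => <-.
by rewrite addnA.
Qed.

(** A form on [B] sees only the end in [B] of a column, so the permanent reduces to a coefficient of
    the product of the forms. *)
Lemma per_B : per [seq row (B_form f) | f <- ls ++ F ++ F] AB_cols != 0.
Proof.
have okA f : f \in ls ++ F ++ F -> form_ok eadj B f.
  by move=> fin; apply: okF; move: fin; rewrite !mem_cat; case: (f \in ls); case: (f \in F).
have -> : per [seq row (B_form f) | f <- ls ++ F ++ F] AB_cols =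
    per [seq (fun c => g c.1) | g <- map B_form (ls ++ F ++ F)] AB_cols.
  apply: eq_per => [|i [b w] lt bw]; first by rewrite !size_map.
  rewrite size_map in lt; pose f0 : relay V * relay V := nth ((false, r, [::]), (false, r, [::])) (ls ++ F ++ F) i.
  rewrite -map_comp !(nth_map f0) //= /row /= (bvec_out (i := w)) ?subr0 //.
    by apply: okA; apply: mem_nth.
  by move: bw; rewrite ABcP => /and3P[].
rewrite per_map per_mcoeff ?size_map ?size_forms // mulf_neq0 //; last first.
  by rewrite pnatr_eq0 -lt0n prodn_gt0 // => i; apply: fact_gt0.
pose fm (f : relay V * relay V) : bform n := (f.1.1, f.2.1).
have -> : \prod_(v <- map B_form (ls ++ F ++ F)) linpoly v = \prod_(f <- ls ++ F ++ F) bform_poly (fm f).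
  by rewrite big_map; apply: eq_bigr => f _; apply: linpoly_bvec.
have H := @prod_sqr_coeff_neq0 n (map fm F) (map fm ls).
rewrite -!map_cat !big_map size_map in H.
have -> : (\sum_(b <- map fst AB_cols) U_(b) = \sum_(l <- ls) U_((fm l).1.2) + \sum_(f <- F) bform_mnm (fm f))%MM.
  rewrite -(perm_big _ chips) /= big_cat /= !big_map big_cat /= -addmA; congr (_ + _)%MM.
  by rewrite -big_split.
apply: H => //; rewrite all_map; apply/allP => f fin /=; rewrite /fm /=.
by have [w []] := okF fin.
Qed.

(* The row [(u, c, o)] is the form [y_u - y_o], where [o] follows [u] in the list of
   upper neighbours of [c]; for the last [u] the exit of [c] replaces [o]. *)
Fixpoint chain (c : V) (s : seq V) : seq (V * V * option V) :=
  if s is u :: s' then (u, c, ohead s') :: chain c s' else [::].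
Definition A_form (t : V * V * option V) (i : V) : int := (i == t.1.1)%:R -
  (if t.2 is Some x then (i == x)%:R else sgz2 (ex t.1.2).1.1 * (i == (ex t.1.2).1.2)%:R).
Definition A_support (t : V * V * option V) :=
  [set t.1.2; t.1.1] :: (if t.2 is Some x then [:: [set t.1.2; x]] else (ex t.1.2).2).

Definition upA_seq c := sort (fun x y => d y <= d x)%N (enum (upA c)).
Definition A_rows := sort (fun x y : V * V * option V => d x.1.1 <= d y.1.1)%N
  (flatten [seq chain c (upA_seq c) | c <- enum needy]).

Lemma upA_seq_mem c u : (u \in upA_seq c) = (u \in upA c).
Proof. by rewrite mem_sort mem_enum. Qed.

Lemma upA_seq_uniq c : uniq (upA_seq c).
Proof. by rewrite sort_uniq enum_uniq. Qed.

Lemma upA_props c u : u \in upA c -> [/\ eadj c u, ~~ B u & u ~< c].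
Proof. by rewrite inE => /and3P. Qed.

(** Strictness holds because all upper neighbours of [c] lie on the path from [c] to the root and so
    have different depths. *)
Lemma upA_seq_sorted c : sorted (fun x y => d y < d x)%N (upA_seq c).
Proof.
have leT : transitive (fun x y : V => d y <= d x)%N by move=> y x z h1 h2; apply: leq_trans h2 h1.
have srt : sorted (fun x y => d y <= d x)%N (upA_seq c).
  by apply: sort_sorted => x y; apply: leq_total.
have := upA_seq_uniq c; have := upA_seq_mem c; move: srt; elim: (upA_seq c) => //= x s IH.
rewrite path_sortedE // => /andP[/allP lex srt] mem /andP[xs us].
rewrite path_sortedE => [|y z t h1 h2]; last exact: ltn_trans h2 h1.
apply/andP; split; last first.
  have in_subtree y : y \in s -> y \in upA c by move=> ys; rewrite -mem inE ys orbT.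
  move: {IH mem lex xs} s srt us in_subtree => s; elim: s => //= y s IH.
  rewrite path_sortedE // => /andP[/allP ley srt] /andP[ys us] in_subtree.
  rewrite path_sortedE => [|a b e h1 h2]; last exact: ltn_trans h2 h1.
  rewrite IH //; last by move=> z zs; apply: in_subtree; rewrite inE zs orbT.
  rewrite andbT; apply/allP => z zs; rewrite ltn_neqAle ley // andbT.
  have [_ _ yc] := upA_props (in_subtree y (mem_head _ _)).
  have [_ _ zc] : [/\ eadj c z, ~~ B z & z ~< c] by apply: upA_props; apply: in_subtree; rewrite inE zs orbT.
  by apply: contraNneq ys => e; rewrite (anc_total_eq yc zc) // e.
apply/allP => z zs; rewrite ltn_neqAle lex // andbT.
have [_ _ yc] : [/\ eadj c x, ~~ B x & x ~< c] by apply: upA_props; rewrite -mem mem_head.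
have [_ _ zc] : [/\ eadj c z, ~~ B z & z ~< c] by apply: upA_props; rewrite -mem inE zs orbT.
by apply: contraNneq xs => e; rewrite (anc_total_eq yc zc) // e.
Qed.

(** The chain uses its first edge once and every other edge twice. Starting it with the link is what
    leaves three loads there. *)
Lemma upA_seq_cons c : needy c -> exists s, upA_seq c = link c :: s.
Proof.
move=> nc; have [_ qu qm] := needyP eadj_sym nt adjC nc.
have := upA_seq_mem c (link c); rewrite qu; have := upA_seq_sorted c; have := upA_seq_mem c.
case: (upA_seq c) => // x s mem srt; rewrite inE => /orP[/eqP ->|qs]; first by exists s.
move: srt => /=; rewrite path_sortedE => [|y z t h1 h2]; last exact: ltn_trans h2 h1.
case/andP => /allP /(_ _ qs) lt _; have := qm x; rewrite -mem mem_head => /(_ isT).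
by rewrite leqNgt lt.
Qed.

Lemma chainP c s t : sorted (fun x y => d y < d x)%N s -> t \in chain c s ->
  [/\ t.1.1 \in s, t.1.2 = c & if t.2 is Some x then x \in s /\ (d x < d t.1.1)%N else True].
Proof.
elim: s => //= u s IH srt; rewrite inE => /orP[/eqP ->|ts] /=.
  split=> //; first by rewrite mem_head.
  by case: s srt {IH} => //= x s /andP[lt _]; rewrite !inE eqxx orbT.
have [m1 -> m2] := IH (path_sorted srt) ts; split=> //; first by rewrite inE m1 orbT.
by case: t.2 m2 => // x [xs ?]; rewrite inE xs orbT.
Qed.

Lemma chain_pairs c s : map fst (chain c s) = [seq (u, c) | u <- s].
Proof. by elim: s => //= u s ->. Qed.

Lemma dataAP t : t \in A_rows -> [/\ needy t.1.2, t.1.1 \in upA t.1.2 &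
  if t.2 is Some x then x \in upA t.1.2 /\ (d x < d t.1.1)%N else True].
Proof.
rewrite mem_sort => /flatten_mapP[c]; rewrite mem_enum => nc /chainP => /(_ (upA_seq_sorted c))[].
rewrite upA_seq_mem => h tc h2; rewrite tc; split=> //.
by case: t.2 h2 => // x [xu lt]; rewrite -upA_seq_mem.
Qed.

Lemma avec_span t : t \in A_rows -> in_span (A_support t) (A_form t) /\ {subset A_support t <= E}.
Proof.
have ne x y : eadj x y -> x != y by apply: contraTneq => ->; rewrite eadj_irr.
case/dataAP; case: t => [[u c] o] /= nc /upA_props[cu _ _] ho.
split.
  change (in_span ([:: [set c; u]] ++ (if o is Some x then [:: [set c; x]] else (ex c).2)) (A_form (u, c, o))).
  case: o ho => [x [/upA_props[cx _ _] _]|_].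
    have := in_span_lin (-1) (in_span_edge (ne _ _ cu)) (in_span_edge (ne _ _ cx)).
    by apply: eq_in_span => i; rewrite /A_form /=; ring.
  have := in_span_lin (-1) (in_span_edge (ne _ _ cu)) (unit_span eadj_irr (exU nc)).
  by apply: eq_in_span => i; rewrite /A_form /=; ring.
move=> e; rewrite inE => /orP[/eqP -> //|].
case: o ho => [x [/upA_props[cx _ _] _]|_]; first by rewrite inE => /eqP ->.
by apply: (unit_subset (fun x y h => h)) (exU nc) _.
Qed.

Lemma per_A : per [seq row (A_form t) | t <- A_rows] (map fst A_rows) != 0.
Proof.
rewrite gt_eqF //; apply: (@per_triangular _ _ (fun t => t.1.1) A_form d (predC B)).
- by apply: sort_sorted => x y; apply: leq_total.
- by rewrite -map_comp.
- move=> t /dataAP[nc /upA_props[_ Bu _] ho].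
  have out i : ~~ B i -> i != t.1.1 -> (d t.1.1 <= d i)%N -> A_form t i = 0.
    rewrite /A_form => Bi /negbTE -> le; case: t.2 ho => [x [_ lt]|_].
      have /negbTE-> : i != x by apply: contraTneq lt => <-; rewrite -leqNgt.
      by rewrite subrr.
    have [Bx _] := relay_origin eadj_sym adjC (exU nc).
    have /negbTE-> : i != (ex t.1.2).1.2 by apply: contraNneq Bi => ->.
    by rewrite mulr0 subrr.
  split; last by move=> x Bx le ne; apply: out.
  rewrite /A_form eqxx; case: t.2 ho => [x [_ lt]|_].
    have /negbTE-> : t.1.1 != x by apply: contraTneq lt => <-; rewrite ltnn.
    by rewrite subr0.
  have [Bx _] := relay_origin eadj_sym adjC (exU nc).
  have /negbTE-> : t.1.1 != (ex t.1.2).1.2 by apply: contraNneq Bu => ->.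
  by rewrite mulr0 subr0.
move=> c /mapP[t /dataAP[/andP[Bc _] /upA_props[_ Bu uc] _] ->] /=; split=> //.
exact: anc_d uc.
Qed.

Definition cols := AB_cols ++ map fst A_rows.

Lemma perm_AAc : perm_eq (map fst A_rows) [seq (u, c) | c <- enum needy, u <- upA_seq c].
Proof.
apply: (@perm_trans _ (map fst (flatten [seq chain c (upA_seq c) | c <- enum needy]))).
  by apply: perm_map; rewrite perm_sort.
rewrite map_flatten -map_comp.
rewrite (eq_map (g := fun c => [seq (u, c) | u <- upA_seq c])) //.
by move=> c /=; rewrite chain_pairs.
Qed.

Lemma AAcP u c : ((u, c) \in map fst A_rows) = needy c && (u \in upA c).
Proof.
rewrite (perm_mem perm_AAc); apply/allpairsPdep/andP => [[c' [u' [+ + [-> ->]]]]|[nc uc]].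
  by rewrite mem_enum upA_seq_mem.
by exists c, u; rewrite mem_enum upA_seq_mem.
Qed.

(** The orientation of a column can be read off its two ends, so different columns have different
    edges. *)
Lemma cols_orient c : c \in cols -> (B c.1 && ~~ B c.2) || [&& ~~ B c.1, ~~ B c.2 & (d c.1 < d c.2)%N].
Proof.
case: c => b w /=; rewrite mem_cat ABcP AAcP => /orP[/and3P[-> -> _] //|/andP[/andP[-> _]]].
by case/upA_props => _ -> /anc_d ->; rewrite orbT.
Qed.

Lemma cols_perm : perm_eq (map (@ends n) cols) (enum E).
Proof.
apply: uniq_perm; rewrite ?enum_uniq //.
  rewrite map_inj_in_uniq.
    rewrite cat_uniq (perm_uniq perm_AAc); apply/and3P; split.
    - apply: allpairs_uniq_dep => [|w _|[w b] [w' b'] _ _ /= [-> ->] //]; exact: enum_uniq.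
    - apply/hasPn => -[u c] /=; rewrite AAcP => /andP[_ /upA_props[_ Bu _]].
      by rewrite ABcP (negbTE Bu) andbF.
    apply: allpairs_uniq_dep => [|w _|[w b] [w' b'] _ _ /= [-> ->] //]; first exact: enum_uniq.
    exact: upA_seq_uniq.
  move=> [a b] [a' b'] /cols_orient /= h /cols_orient /= h' /set2_eq[] //=.
    by apply: contraTneq h => ->; rewrite ltnn !andbF; case: (B b).
  by case=> ea eb; subst a' b'; move: h h'; case: (B a); case: (B b) => //=; lia.
move=> e; rewrite mem_enum; apply/mapP/idP => [[[a b] + ->]|eE].
  rewrite mem_cat ABcP AAcP /ends /= => /orP[/and3P[_ _]|/andP[_ /upA_props[]]];
    by rewrite /eadj setUC.
have [x [y ee]] : exists x y, e = [set x; y].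
  by have /eqP/cards2P[x [y [_ ->]]] := gE eE; exists x, y.
have xy : eadj x y by rewrite /eadj -ee.
have yx : eadj y x by rewrite eadj_sym.
wlog anc_xy : x y ee xy yx / x ~< y.
  move=> H; case/orP: (nt.2 x y (adjC xy) xy) => h; first exact: (H x y).
  by apply: (H y x) => //; rewrite ee setUC.
have [Bx|Bx] := boolP (B x); have [By|By] := boolP (B y).
- by case: (B_indep eadj_sym nt adjC Bspec xy Bx By).
- by exists (x, y); rewrite // mem_cat ABcP By Bx yx.
- by exists (y, x); rewrite ?mem_cat ?ABcP ?By ?Bx ?xy // /ends setUC.
have xu : x \in upA y by rewrite inE yx Bx.
exists (x, y); rewrite // mem_cat AAcP xu andbT /needy By; apply/orP; right.
by apply/set0Pn; exists x.
Qed.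

Lemma count_chain e c s : s != [::] -> (count_mem e (flatten (map A_support (chain c s))) =
  count_mem e [seq [set c; u] | u <- s] + count_mem e [seq [set c; u] | u <- behead s]
  + count_mem e (ex c).2)%N.
Proof.
elim: s => // u s IH _; case: s IH => [_|x s IH] /=; first by rewrite cats0 addn0 addn0.
by have /= -> := IH isT; lia.
Qed.

Lemma cert_assembly : cert E 4.
Proof.
exists ([seq (B_form f, f.1.2 ++ f.2.2) | f <- ls ++ F ++ F] ++ [seq (A_form t, A_support t) | t <- A_rows]), cols.
have okA f : f \in ls ++ F ++ F -> form_ok eadj B f.
  by move=> fin; apply: okF; move: fin; rewrite !mem_cat; case: (f \in ls); case: (f \in F).
split.
- exact: cols_perm.
- by rewrite /cols !size_cat !size_map -size_forms !size_cat.
- apply: Alls_cat; apply: Alls_map; apply: Alls_in => f fin; first exact/bvec_span/okA.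
  exact: avec_span.
- move=> e; rewrite map_cat flatten_cat count_cat -!map_comp /=.
  have cntE : (count_mem e (map (@ends n) cols) <= 1)%N.
    by rewrite (permP cols_perm) count_uniq_mem ?enum_uniq // leq_b1.
  apply: leq_trans (_ : 4 * count_mem e (map (@ends n) cols) <= 4)%N; last by lia.
  have cA : count_mem e (flatten [seq A_support t | t <- A_rows]) = (\sum_(c | needy c)
      (count_mem e [seq [set c; u] | u <- upA_seq c] + count_mem e [seq [set c; u] | u <- behead (upA_seq c)]
       + count_mem e (ex c).2))%N.
    have -> : count_mem e (flatten [seq A_support t | t <- A_rows]) =
        count_mem e (flatten [seq A_support t | t <- flatten [seq chain c (upA_seq c) | c <- enum needy]]).
      by apply/permP; apply: perm_flatten; apply: perm_map; rewrite perm_sort.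
    rewrite -[RHS]big_enum /=; have : all needy (enum needy) by apply/allP => x; rewrite mem_enum.
    elim: (enum _) => [|c s IH] /=; first by rewrite big_nil.
    case/andP => nc /IH {}IH; rewrite map_cat flatten_cat count_cat IH big_cons count_chain //.
    by have [s' ->] := upA_seq_cons nc.
  have cC : count_mem e (map (@ends n) cols) = (count_mem e [seq [set c.2; c.1] | c <- AB_cols]
      + \sum_(c | needy c) count_mem e [seq [set c; u] | u <- upA_seq c])%N.
    rewrite map_cat count_cat; congr (_ + _)%N.
      by congr (count_mem e _); apply: eq_map => c; rewrite /ends setUC.
    rewrite (permP (perm_map _ perm_AAc)) -big_enum /=.
    elim: (enum _) => [|c s IH] /=; first by rewrite big_nil.
    rewrite map_cat count_cat IH big_cons -map_comp; congr (_ + _)%N.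
    by congr (count_mem e _); apply: eq_map => u; rewrite /ends /= setUC.
  have cB : count_mem e (flatten [seq f.1.2 ++ f.2.2 | f <- ls ++ F ++ F]) =
     (2 * count_mem e (flatten [seq f.1.2 ++ f.2.2 | f <- F]) +
         count_mem e (flatten [seq f.1.2 ++ f.2.2 | f <- ls]))%N.
    by rewrite !map_cat !flatten_cat !count_cat mul2n -addnn addnC.
  rewrite cB cA cC !big_split /=; have := loads e.
  (* For each [c], the link is used once by the chain and three times by the budget, and the other
     upper edges are used twice. *)
  have : (\sum_(c | needy c) count_mem e [seq [set c; u] | u <- upA_seq c] +
     \sum_(c | needy c) count_mem e [seq [set c; u] | u <- behead (upA_seq c)] +
     3 * \sum_(c | needy c) ([set c; link c] == e) <=
     4 * \sum_(c | needy c) count_mem e [seq [set c; u] | u <- upA_seq c])%N.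
    rewrite !big_distrr -!big_split /=; apply: leq_sum => c nc.
    have [s ->] := upA_seq_cons nc; rewrite /=.
    by move: (count_mem e _) (nat_of_bool _) => a b; lia.
  move: (\sum_(c | needy c) count_mem e [seq [set c; u] | u <- upA_seq c])%N => a.
  move: (\sum_(c | needy c) count_mem e [seq [set c; u] | u <- behead (upA_seq c)])%N => b.
  move: (\sum_(c | needy c) ([set c; link c] == e))%N (\sum_(c | needy c) count_mem e (ex c).2)%N => a' b'.
  by move: (count_mem e _) (count_mem e _) (count_mem e _) => x y z; lia.
rewrite map_cat -!map_comp /cols per_block ?size_map ?size_forms //; last first.
  move=> i c lt /mapP[t td ->]; have [/andP[Bc _] /upA_props[_ Bu _] _] := dataAP td.
  pose f0 : relay V * relay V := ((false, r, [::]), (false, r, [::])).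
  move: lt; rewrite ?size_map -?size_forms => lt.
  rewrite (nth_map f0) //= /row !bvec_out ?subrr //; apply: okA; exact: mem_nth.
by rewrite mulf_neq0 //; [apply: per_B | apply: per_A].
Qed.
End Assembly.

Lemma cert_component : (forall b, exists x, [/\ C x, x != r & x != b]) -> cert E 4.
Proof.
move=> nK2; have [p [d nt]] := normal_tree_exists r eadj_sym eadj_irr.
have [B Bspec] : exists B : pred V, forall v, B v =
    ~~ [exists u, (eadj v u && anc p d v u) && B u].
  by apply: (@greedy_kernel _ (fun v u => eadj v u && anc p d v u) d) => x y /andP[_ /anc_d].
have [ls [F [ex [h1 h2 h3 h4 h5]]]] := forms_exist eadj_sym nt adjC Bspec nK2.
exact: (cert_assembly nt Bspec h1 h2 h3 h4 h5).
Qed.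
End Component.

(** Induction on the number of edges: the component of one edge is split off, and the rest is nice
    again because the degrees at its edges do not change. *)
Lemma nice_cert n (E : {set {set 'I_n}}) : is_graph E -> nice E -> cert E 4.
Proof.
have [m] := ubnP #|E|; elim: m E => // m IH E lt gE nE.
have [->|[e0 e0E]] := set_0Vmem E.
  exists [::], [::]; split=> //=; first by rewrite enum_set0.
have /eqP/cards2P[x [y [xy ee0]]] := gE _ e0E; subst e0.
pose C := connect (eadj E) x.
have Cx : C x by apply: connect0.
have Cadj a b : eadj E a b -> C a = C b.
  exact: (adj_connect x (@eadj_sym _ E)).
have Cend e a b : e \in E -> a \in e -> b \in e -> C a = C b.
  move=> eE; have /eqP/cards2P[u [v [_ ee]]] := gE _ eE; subst e.
  have uv := Cadj u v eE; rewrite !inE.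
  by case/orP => /eqP -> /orP[] /eqP ->.
pose E1 := [set e in E | [exists i in e, C i]].
have E1P e i : e \in E -> i \in e -> (e \in E1) = C i.
  move=> eE ie; rewrite inE eE /=; apply/existsP/idP => [[j /andP[je]]|Ci]; last by exists i; rewrite ie.
  by rewrite (Cend e i j).
have sub1 : E1 \subset E by apply/subsetP => e; rewrite inE => /andP[].
have E12 : E = E1 :|: (E :\: E1) by rewrite -{1}(setID E E1) (setIidPr sub1).
have x1 : [set x; y] \in E1 by rewrite (E1P _ x) // !inE eqxx.
have g1 : is_graph E1 by move=> e /(subsetP sub1)/gE.
have path1 z s : C z -> path (eadj E) z s -> path (eadj E1) z s.
  elim: s z => //= v s IHs z Cz /andP[zv /IHs H]; rewrite H -?(Cadj _ _ zv) // andbT.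
  by rewrite /eadj (E1P _ z) // !inE eqxx.
have C1 a : C a -> connect (eadj E1) x a.
  by case/connectP => s ps ->; apply/connectP; exists s => //; apply: path1.
have adj1 a b : eadj E1 a b -> connect (eadj E1) x a.
  move=> ab; apply: C1; have abE := subsetP sub1 _ ab.
  by rewrite -(E1P _ a abE) // !inE eqxx.
rewrite E12; apply: cert_union => //.
- move=> e1 e2 e1E; rewrite inE => /andP[e2n e2E]; rewrite -setI_eq0; apply/eqP/setP => i.
  rewrite !inE; apply/negP => /andP[i1 i2]; case/negP: e2n.
  by rewrite (E1P _ i) // -(E1P e1 i) // (subsetP sub1).
- apply: (@cert_component _ E1 x g1 adj1) => b.
  (* If the component had no vertex besides [x] and [y], its edge would be isolated. *)
  have [/existsP[v /and3P[Cv vx vb]]|/existsPn H] := boolP [exists v, [&& C v, v != x & v != b]].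
    by exists v; split=> //; apply: C1.
  have CyP v : C v -> v \in [set x; y].
    have yb : y = b.
      have := H y; rewrite -(Cend _ x y e0E) ?inE ?eqxx ?orbT // Cx eq_sym xy /= negbK.
      by move/eqP.
    by move=> Cv; have := H v; rewrite Cv !inE /= -negb_or negbK yb.
  case: (nE _ e0E) => i ixy; rewrite /deg (_ : inc_edges E i = [set [set x; y]]) ?cards1 //.
  apply/setP => e; rewrite !inE; apply/andP/eqP => [[eE ie]|-> //].
  apply/eqP; rewrite eqEcard (gE _ eE) (gE _ e0E) leqnn andbT.
  by apply/subsetP => j je; apply: CyP; rewrite -(Cend e i) // (Cend _ i x e0E) // !inE eqxx.
apply: IH.
- rewrite ltnS in lt; apply: leq_trans lt; apply: proper_card; rewrite properEneq subsetDl andbT.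
  by apply/eqP => e; move: e0E; rewrite -e inE x1.
- by move=> e; rewrite inE => /andP[_ /gE].
move=> e; rewrite inE => /andP[e1 eE] H; apply: (nE e eE) => i ie; rewrite -(H i ie) /deg.
apply: eq_card => f; rewrite !inE; case fE: (f \in E) => //=; case fi: (i \in f); rewrite ?andbF ?andbT //.
by move: e1; rewrite (E1P e i) // -(E1P f i) // inE fE.
Qed.

Theorem theorem5p1 (n : nat) (E : {set {set 'I_n}}) :
  is_graph E -> nice E -> alg_choosable E 5.
Proof. by move=> gE nE; apply: cert_choosable => //; apply: nice_cert. Qed.
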